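(* Let $\pi$ be a finitely generated torsion-free nilpotent group, let $\phi:\pi\to\pi$ be an endomorphism, and let $D:G\to G$ be the Malcev completion of $\phi$, with differential $D_*$ and diagonal blocks $D_1,D_2,\dots$. Let $\phi_{\mathrm{ab}}:\pi/[\pi,\pi]\to\pi/[\pi,\pi]$ be the endomorphism induced by $\phi$. Then $$\mathrm{GR}(\phi)=\mathrm{GR}(\phi_{\mathrm{ab}}).$$ Hence $\mathrm{GR}(\phi)=\mathrm{sp}(D_1)\le \mathrm{sp}(D_* )$.
   Context: Growth rate: let $\pi$ be a group generated by a finite set $S=\{s_1,\dots,s_n\}$. For $\gamma\in\pi$, $L(\gamma,S)$ is the length of a shortest word in the letters $S\cup S^{-1}$ representing $\gamma$. For an endomorphism $\phi$ of $\pi$ put $L_k(\phi,S)=\max_i L(\phi^k(s_i),S)$; then $\mathrm{GR}(\phi):=\lim_{k\to\infty}L_k(\phi,S)^{1/k}$. This limit exists, equals $\inf_k L_k(\phi,S)^{1/k}$, and is independent of the choice of $S$. Linearization: let $\pi$ be a finitely generated torsion-free nilpotent group that is $c$-step, with lower central series $\pi_1=\pi$, $\pi_{j+1}=[\pi,\pi_j]$, $\pi_{c+1}=1$. The isolator of $\pi_j$ is $\sqrt{\pi_j}=\{x\in\pi\mid x^k\in\pi_j\text{ for some }k\ge1\}$. These are characteristic subgroups of $\pi$, and $\sqrt{\pi_j}/\sqrt{\pi_{j+1}}\cong\mathbb{Z}^{k_j}$ for $1\le j\le c$. The Malcev completion $G$ of $\pi$ is the connected, simply connected nilpotent Lie group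 containing $\pi$ as a lattice; $\mathfrak{G}$ is its Lie algebra. Every endomorphism $\phi$ of $\pi$ extends uniquely to a Lie group endomorphism $D:G\to G$, called the Malcev completion of $\phi$, and its differential $D_*:\mathfrak{G}\to\mathfrak{G}$ is called the linearization of $\phi$. Choose subsets $\mathcal{S}_j\subset\sqrt{\pi_j}$ projecting to bases of the free abelian groups $\sqrt{\pi_j}/\sqrt{\pi_{j+1}}$ $(1\le j\le c)$. With respect to the linear basis $\{\log \mathcal{S}_1,\dots,\log\mathcal{S}_c\}$ of $\mathfrak{G}$, $D_*$ is a lower triangular block matrix whose $j$-th diagonal block $D_j$ is the $k_j\times k_j$ integer matrix of the endomorphism of $\sqrt{\pi_j}/\sqrt{\pi_{j+1}}\cong\mathbb{Z}^{k_j}$ induced by $\phi$. $\mathrm{sp}(X)$ denotes the maximum of the absolute values of the eigenvalues of $X$. *)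

(* Defs.v *)
From HB Require Import structures.
From mathcomp Require Import all_boot all_order all_algebra.
From mathcomp Require Import generic_quotient.
From mathcomp Require Import all_classical all_reals all_analysis.
From mathcomp.real_closed Require Import complex.

Set Implicit Arguments.
Unset Strict Implicit.
Unset Printing Implicit Defensive.

Import Order.TTheory GRing.Theory Num.Theory.
Import numFieldNormedType.Exports.

Local Open Scope classical_set_scope.
Local Open Scope ring_scope.

Record subgroup (G : groupType) := Subgroup {
  sg_set :> G -> Prop;
  sg_one : sg_set 1%g;
  sg_mul : forall x y, sg_set x -> sg_set y -> sg_set (x * y)%g;
  sg_inv : forall x, sg_set x -> sg_set (x^-1)%g
}.

Section Subgroups.
Context (G : groupType).

Definition full_subgroup : subgroup G :=
  @Subgroup G setT I (fun _ _ _ _ => I) (fun _ _ => I).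

Program Definition generated (A : set G) : subgroup G :=
  @Subgroup G [set x | forall H : subgroup G, (forall y, A y -> H y) -> H x] _ _ _.
Next Obligation. by move=> A H _; apply: sg_one. Qed.
Next Obligation.
by move=> A x y hx hy H AH; apply: sg_mul; [apply: hx | apply: hy].
Qed.
Next Obligation. by move=> A x hx H AH; apply: sg_inv; apply: hx. Qed.

Definition generates (S : seq G) : Prop := forall x, generated [set` S] x.

Definition commutator_with (H : subgroup G) : subgroup G :=
  generated [set z | exists x y, H y /\ z = ([~ x, y])%g].

(* [lcs 1] is G and [lcs j.+1] is [G, lcs j] for [j >= 1]; the index 0 is a
   junk value, also G. *)
Definition lcs (j : nat) : subgroup G :=
  iter j.-1 commutator_with full_subgroup.

Definition nilpotent_group : Prop := exists c, forall x, lcs c.+1 x -> x = 1%g.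

Definition torsion_free : Prop :=
  forall (x : G) k, (0 < k)%N -> (x ^+ k)%g = 1%g -> x = 1%g.

Definition isolator (j : nat) : set G :=
  [set x | exists2 k, (1 <= k)%N & lcs j (x ^+ k)%g].

Definition zpowg (x : G) (m : int) : G :=
  match m with Posz p => (x ^+ p)%g | Negz p => (x ^- p.+1)%g end.

(* The family [s] lies in the isolator of the j-th term and its classes form a
   Z-basis of the quotient by the next isolator. *)
Definition isolator_basis (j k : nat) (s : 'I_k -> G) : Prop :=
  (forall i, isolator j (s i)) /\
  forall x, isolator j x ->
    exists! a : 'cV[int]_k,
      isolator j.+1 ((\prod_(i < k) zpowg (s i) (a i ord0))^-1 * x)%g.

(* Column l of [M] holds the coordinates of the class of [phi (s l)]. *)
Definition induced_matrix (phi : {multiplicative G -> G}) (j k : nat)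
    (s : 'I_k -> G) (M : 'M[int]_k) : Prop :=
  forall l,
    isolator j.+1 ((\prod_(i < k) zpowg (s i) (M i l))^-1 * phi (s l))%g.

End Subgroups.

Arguments nilpotent_group : clear implicits.
Arguments torsion_free : clear implicits.
Arguments lcs : clear implicits.

Section WordLength.
Context (G : groupType).

Definition word_of_size (S : seq G) (x : G) (m : nat) : Prop :=
  exists w : seq G, [/\ size w = m,
    {subset w <= S ++ [seq (y^-1)%g | y <- S]} & (\prod_(y <- w) y)%g = x].

(* 0 (junk) if no word in S and its inverses represents x *)
Definition word_length (S : seq G) (x : G) : nat :=
  if pselect (exists m, `[< word_of_size S x m >]) is left ex
  then ex_minn ex else 0%N.

Definition max_length (phi : G -> G) (S : seq G) (k : nat) : nat :=
  \max_(x <- S) word_length S (iter k phi x).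

Definition GR (R : realType) (phi : {multiplicative G -> G}) (S : seq G) : R :=
  lim ((fun k : nat => ((max_length phi S k)%:R : R) `^ (k%:R^-1)) @ \oo).

End WordLength.

Section Cosets.
Context (G : groupType) (H : subgroup G).

Definition coset_rel : rel G := fun x y => `[< H (x^-1 * y)%g >].

Lemma coset_rel_refl : reflexive coset_rel.
Proof. by move=> x; apply/asboolP; rewrite mulVg; apply: sg_one. Qed.

Lemma coset_rel_sym : symmetric coset_rel.
Proof.
have s x y : coset_rel x y -> coset_rel y x.
  move=> /asboolP h; apply/asboolP.
  by have := sg_inv h; rewrite invgM invgK.
by move=> x y; apply/idP/idP; apply: s.
Qed.

Lemma coset_rel_trans : transitive coset_rel.
Proof.
move=> y x z /asboolP h1 /asboolP h2; apply/asboolP.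
by have := sg_mul h1 h2; rewrite mulgA mulgK.
Qed.

Canonical coset_equiv :=
  EquivRel coset_rel coset_rel_refl coset_rel_sym coset_rel_trans.

Definition coset_space := {eq_quot coset_equiv}%qT.
HB.instance Definition _ := Choice.on coset_space.
HB.instance Definition _ := Quotient.on coset_space.
HB.instance Definition _ := EqQuotient.on coset_space.

End Cosets.

Section Abelianization.
Context (G : groupType).
Local Open Scope quotient_scope.

Definition derived : subgroup G := commutator_with (full_subgroup G).

Definition abelianization := coset_space derived.
HB.instance Definition _ := Choice.on abelianization.
HB.instance Definition _ := Quotient.on abelianization.

Definition ab_proj (x : G) : abelianization := \pi_(coset_space derived) x.

Lemma derived_commg (x y : G) : derived ([~ x, y])%g.
Proof. by move=> H; apply; exists x, y. Qed.

Lemma derived_conj (x y : G) : derived x -> derived (x ^ y)%g.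
Proof.
move=> dx; have -> : (x ^ y = x * [~ x, y])%g by rewrite commgEl mulVKg.
exact: sg_mul (derived_commg _ _).
Qed.

Lemma ab_projP (x y : G) : ab_proj x = ab_proj y <-> derived (x^-1 * y)%g.
Proof.
split; first by move=> /eqmodP /asboolP.
by move=> h; apply/eqmodP/asboolP.
Qed.

Lemma ab_reprP (x : abelianization) : ab_proj (repr x) = x.
Proof. exact: (@reprK _ (coset_space derived)). Qed.

Definition ab_mul (x y : abelianization) := ab_proj (repr x * repr y)%g.
Definition ab_inv (x : abelianization) := ab_proj (repr x)^-1%g.

Lemma ab_mulE x y : ab_mul (ab_proj x) (ab_proj y) = ab_proj (x * y)%g.
Proof.
apply/ab_projP; set a := repr _; set b := repr _.
have /ab_projP ha : ab_proj a = ab_proj x by rewrite ab_reprP.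
have /ab_projP hb : ab_proj b = ab_proj y by rewrite ab_reprP.
have -> : ((a * b)^-1 * (x * y) = (a^-1 * x) ^ b * (b^-1 * y))%g.
  by rewrite conjgE invgM !mulgA mulgK.
by apply: sg_mul hb; apply: derived_conj.
Qed.

Lemma ab_invE x : ab_inv (ab_proj x) = ab_proj (x^-1)%g.
Proof.
apply/ab_projP; set a := repr _; rewrite invgK.
have /ab_projP ha : ab_proj a = ab_proj x by rewrite ab_reprP.
have -> : (a * x^-1 = ((a^-1 * x)^-1) ^ (a^-1))%g.
  by rewrite conjgE invgM !invgK !mulgA mulgK.
by apply: derived_conj; apply: sg_inv.
Qed.

Lemma ab_mulA : associative ab_mul.
Proof.
move=> x y z; rewrite -[x]ab_reprP -[y]ab_reprP -[z]ab_reprP.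
by rewrite !ab_mulE mulgA.
Qed.

Lemma ab_mul1 : left_id (ab_proj 1%g) ab_mul.
Proof. by move=> x; rewrite -[x]ab_reprP ab_mulE mul1g. Qed.

Lemma ab_1mul : right_id (ab_proj 1%g) ab_mul.
Proof. by move=> x; rewrite -[x]ab_reprP ab_mulE mulg1. Qed.

Lemma ab_mulV : left_inverse (ab_proj 1%g) ab_inv ab_mul.
Proof. by move=> x; rewrite -[x]ab_reprP ab_invE ab_mulE mulVg. Qed.

Lemma ab_mulgV : right_inverse (ab_proj 1%g) ab_inv ab_mul.
Proof. by move=> x; rewrite -[x]ab_reprP ab_invE ab_mulE mulgV. Qed.

HB.instance Definition _ := @isGroup.Build abelianization
  (ab_proj 1%g) ab_inv ab_mul ab_mulA ab_mul1 ab_1mul ab_mulV ab_mulgV.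

Lemma ab_projM : {morph ab_proj : x y / (x * y)%g}.
Proof. by move=> x y; rewrite -ab_mulE. Qed.

HB.instance Definition _ := isMultiplicative.Build G abelianization ab_proj
  ab_projM.

Context (phi : {multiplicative G -> G}).

Definition ab_map (x : abelianization) : abelianization :=
  ab_proj (phi (repr x)).

Lemma gmul_phi1 : phi 1%g = 1%g.
Proof. by apply: (mulgI (phi 1%g)); rewrite -gmulfM !mulg1. Qed.

Lemma gmul_phiV x : phi (x^-1)%g = (phi x)^-1%g.
Proof. by apply: (mulgI (phi x)); rewrite -gmulfM !mulgV gmul_phi1. Qed.

Lemma phi_derived x : derived x -> derived (phi x).
Proof.
move=> dx.
have h1 : derived (phi 1%g) by rewrite gmul_phi1; apply: sg_one.
have hM x1 x2 : derived (phi x1) -> derived (phi x2) ->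
    derived (phi (x1 * x2)%g).
  by rewrite gmulfM; apply: sg_mul.
have hV x1 : derived (phi x1) -> derived (phi (x1^-1)%g).
  by rewrite gmul_phiV; apply: sg_inv.
apply: (dx (@Subgroup G (fun y => derived (phi y)) h1 hM hV)) => _ [y [z [_ ->]]].
by rewrite /= /commg /conjg !gmulfM !gmul_phiV; apply: derived_commg.
Qed.

Lemma ab_mapE x : ab_map (ab_proj x) = ab_proj (phi x).
Proof.
apply/ab_projP; rewrite -gmul_phiV -gmulfM; apply: phi_derived.
by apply/ab_projP; rewrite ab_reprP.
Qed.

Lemma ab_mapM : {morph ab_map : x y / (x * y)%g}.
Proof.
move=> x y; rewrite -[x]ab_reprP -[y]ab_reprP -ab_projM !ab_mapE.
by rewrite gmulfM ab_projM.
Qed.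

HB.instance Definition _ := isMultiplicative.Build _ _ ab_map ab_mapM.

End Abelianization.

Section SpectralRadius.
Context (R : realType).

(* The set is finite, so its supremum is a maximum; it is empty, with supremum
   0, exactly when n = 0. *)
Definition sp (n : nat) (A : 'M[R]_n) : R :=
  sup [set @ComplexField.Normc.normc R z |
        z in [set z : R[i]%C | eigenvalue (map_mx (real_complex R) A) z]].

End SpectralRadius.

Section Smooth.
Context (R : realType) (V W : normedModType R).

(* C^k on an open set: in finite dimension, f is C^(k+1) iff it is
   differentiable and all its directional derivatives are C^k. *)
Fixpoint Ck_on (k : nat) (A : set V) (f : V -> W) : Prop :=
  match k with
  | 0 => forall x, A x -> {for x, continuous f}
  | k'.+1 => (forall x, A x -> differentiable f x) /\
             forall v, Ck_on k' A (fun x => 'd f x v)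
  end.

Definition smooth_on (A : set V) (f : V -> W) : Prop :=
  open A /\ forall k, Ck_on k A f.

End Smooth.

Record chart (R : realType) (n : nat) (M : topologicalType) := Chart {
  cdom : set M;
  cmap : M -> 'rV[R]_n;
  cinv : 'rV[R]_n -> M;
  cdom_open : open cdom;
  cimg_open : open (cmap @` cdom);
  cmapK : forall x, cdom x -> cinv (cmap x) = x;
  cmap_continuous : {within cdom, continuous cmap};
  cinv_continuous : {within cmap @` cdom, continuous cinv}
}.

HB.mixin Record isManifold (R : realType) (n : nat) (M : Type)
    & Topological M := {
  atlas : set (chart R n M);
  manifold_hausdorff : hausdorff_space M;
  manifold_second_countable : @second_countable M;
  atlas_cover : forall x : M, exists2 c, atlas c & cdom c x;
  atlas_smooth : forall c d, atlas c -> atlas d ->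
    smooth_on (cmap c @` (cdom c `&` cdom d)) (cmap d \o cinv c)
}.

#[short(type="manifoldType")]
HB.structure Definition Manifold (R : realType) (n : nat) :=
  {M of Topological M & isManifold R n M}.

Definition smooth_map (R : realType) (m n : nat)
    (M : manifoldType R m) (N : manifoldType R n) (f : M -> N) : Prop :=
  continuous f /\
  forall c d, @atlas R m M c -> @atlas R n N d ->
    smooth_on (cmap c @` (cdom c `&` f @^-1` cdom d))
              (cmap d \o f \o cinv c).

(* There is no product manifold here: smoothness of f on M x M is tested in the
   product charts. *)
Definition smooth_map2 (R : realType) (m : nat)
    (M : manifoldType R m) (f : M -> M -> M) : Prop :=
  continuous (fun p : M * M => f p.1 p.2) /\
  forall c1 c2 d, @atlas R m M c1 -> @atlas R m M c2 -> @atlas R m M d ->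
    smooth_on
      [set (cmap c1 p.1, cmap c2 p.2) | p in
         [set p : M * M | [/\ cdom c1 p.1, cdom c2 p.2 & cdom d (f p.1 p.2)]]]
      (fun u : 'rV[R]_m * 'rV[R]_m => cmap d (f (cinv c1 u.1) (cinv c2 u.2))).

HB.mixin Record isLieGroup (R : realType) (n : nat) (G : Type)
    & Manifold R n G & Group G := {
  lie_mul_smooth : @smooth_map2 R n G (fun x y : G => (x * y)%g);
  lie_inv_smooth : @smooth_map R n n G G (fun x : G => (x^-1)%g)
}.

#[short(type="lieGroupType")]
HB.structure Definition LieGroup (R : realType) (n : nat) :=
  {G of Group G & Manifold R n G & isLieGroup R n G}.

Definition simply_connected (R : realType) (M : topologicalType) : Prop :=
  connected [set: M] /\
  forall g : R -> M, {within `[0, 1], continuous g} -> g 0 = g 1 ->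
    exists h : R * R -> M,
      [/\ {within `[0, 1] `*` `[0, 1], continuous h},
          forall t, t \in `[0, 1] -> h (0, t) = g t /\ h (1, t) = g 0 &
          forall s, s \in `[0, 1] -> h (s, 0) = g 0 /\ h (s, 1) = g 0].

Section Malcev.
Context (R : realType) (n : nat) (G : lieGroupType R n) (pi : groupType).
Context (iota : {multiplicative pi -> G}).

Program Definition image_subgroup : subgroup G :=
  @Subgroup G (range iota) _ _ _.
Next Obligation.
exists 1%g => //.
by apply: (mulgI (iota 1%g)); rewrite -gmulfM !mulg1.
Qed.
Next Obligation.
by move=> _ _ [x _ <-] [y _ <-]; exists (x * y)%g => //; rewrite gmulfM.
Qed.
Next Obligation.
move=> _ [x _ <-]; exists (x^-1)%g => //.
apply: (mulgI (iota x)); rewrite -gmulfM !mulgV.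
by apply: (mulgI (iota 1%g)); rewrite -gmulfM !mulg1.
Qed.

(* [iota] identifies pi with a discrete cocompact subgroup of G. *)
Definition is_lattice : Prop :=
  [/\ injective iota,
      (forall x, range iota x -> \forall y \near x, range iota y -> y = x) &
      compact [set: quotient_topology (coset_space image_subgroup)]].

Definition is_malcev_completion : Prop :=
  [/\ simply_connected R G, nilpotent_group G & is_lattice].

Definition is_malcev_extension (phi : {multiplicative pi -> pi})
    (D : {multiplicative G -> G}) : Prop :=
  smooth_map D /\ forall x, D (iota x) = iota (phi x).

(* The matrix of the differential at 1 of D in the coordinates on T_1 G given
   by the chart c; it acts on row vectors. *)
Definition linearization (c : chart R n G) (D : {multiplicative G -> G}) :
    'M[R]_n :=
  jacobian (cmap c \o D \o cinv c) (cmap c 1%g).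

End Malcev.

(* Main.v *)
Require Import Defs.
From HB Require Import structures.
From mathcomp Require Import all_boot all_order all_algebra.
From mathcomp Require Import generic_quotient ring lra.
From mathcomp Require Import all_classical all_reals all_analysis.
From mathcomp.real_closed Require Import complex.

(** Upper bound for [GR phi]: let [r > sp D1 >= 1]. In the abelianization
    [phi ^ k] stretches lengths by at most [C r ^ k]. By induction on [j]
    the same holds modulo the [j]-th term of the lower central series: if
    [w], [w'] are short approximations of [phi ^ k x], [phi ^ k y] modulo
    the [j]-th term, then [[~ w, w']] equals [phi ^ k [~ x, y]] modulo the
    next one, so the commutator subgroup grows at rate [r]; a generator then
    grows by at most [r ^ p / 2] under [phi ^ p], up to such an error term.
    If [sp D1 < 1] the integer matrix [D1] is nilpotent and so is [phi]. The
    lower bound comes from the coordinates in [Z ^ k1], which are Lipschitz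
    for word length.

    For [sp D1 <= sp D_*] no Lie algebra is needed. Let [r > sp D_*]. Near
    the identity [D] stretches an adapted norm by at most [r]. If [r < 1],
    then [D ^ k -> 1] pointwise, so [phi ^ k] dies by discreteness and [D1]
    is nilpotent. If [r >= 1], an element of [G] is a product of [C r ^ k]
    elements of size [r ^ - k], hence its image under [D ^ k] is a product
    of [C r ^ k] elements of a fixed compact set, and by the Milnor-Schwarz
    argument lengths in the lattice grow at most like [r ^ k]. *)

Set Implicit Arguments.
Unset Strict Implicit.
Unset Printing Implicit Defensive.

Import Order.TTheory GRing.Theory Num.Theory.
Import numFieldNormedType.Exports.

Local Open Scope classical_set_scope.
Local Open Scope ring_scope.

(** * Lower central series and word length *)

Section LowerCentralSeries.
Context (G : groupType).
Local Open Scope group_scope.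
Implicit Types (x y z u : G) (j : nat).

Lemma generated_gen (A : set G) x : A x -> generated A x.
Proof. by move=> Ax H; apply. Qed.

Lemma generated_ind (A : set G) (P : G -> Prop) :
  P 1 -> (forall x y, P x -> P y -> P (x * y)) ->
  (forall x, P x -> P x^-1) -> (forall x, A x -> P x) ->
  forall x, generated A x -> P x.
Proof. by move=> P1 PM PV PA x gx; apply: (gx (@Subgroup G P P1 PM PV)). Qed.

Lemma lcs_comm j x y : (0 < j)%N -> lcs G j y -> lcs G j.+1 [~ x, y].
Proof. by case: j => // j _ hy; apply: generated_gen; exists x, y. Qed.

Lemma lcs_comm' j x y : (0 < j)%N -> lcs G j y -> lcs G j.+1 [~ y, x].
Proof. by move=> j0 hy; rewrite -invgR; apply/sg_inv/lcs_comm. Qed.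

Lemma lcs_conj j x y : lcs G j x -> lcs G j (x ^ y).
Proof.
elim: j x y => [//|[|j] IH] x y //;
  apply: (generated_ind (P := fun x => lcs G j.+2 (x ^ y))).
- by rewrite conj1g; apply: sg_one.
- by move=> a b ha hb; rewrite conjMg; apply: sg_mul.
- by move=> a ha; rewrite conjVg; apply: sg_inv.
- by move=> _ [a [b [hb ->]]]; rewrite conjRg; apply: lcs_comm => //; apply: IH.
Qed.

Lemma lcsS j x : lcs G j.+1 x -> lcs G j x.
Proof.
case: j => // j; apply: generated_ind.
- exact: sg_one.
- exact: sg_mul.
- exact: sg_inv.
- move=> _ [a [b [hb ->]]]; rewrite commgEr; apply: sg_mul => //.
  by apply: lcs_conj; apply: sg_inv.
Qed.

(** Stated through left cosets; normality of the terms ([lcs_conj]) makes it a congruence for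
    products and inverses. *)
Definition lcs_eq j x y := lcs G j (x^-1 * y).

Lemma lcs_eq_refl j x : lcs_eq j x x.
Proof. by rewrite /lcs_eq mulVg; apply: sg_one. Qed.

Lemma lcs_eq_sym j x y : lcs_eq j x y -> lcs_eq j y x.
Proof. by move=> /sg_inv; rewrite invgM invgK. Qed.

Lemma lcs_eq_trans j x y z : lcs_eq j x y -> lcs_eq j y z -> lcs_eq j x z.
Proof. by move=> h1 h2; have := sg_mul h1 h2; rewrite mulgA mulgK. Qed.

Lemma lcs_eq_mul j x y x' y' : lcs_eq j x x' -> lcs_eq j y y' ->
  lcs_eq j (x * y) (x' * y').
Proof.
move=> /(lcs_conj y) h1 h2; have := sg_mul h1 h2.
by rewrite /lcs_eq conjgE invgM !mulgA mulgK.
Qed.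

Lemma lcs_eq_inv j x x' : lcs_eq j x x' -> lcs_eq j x^-1 x'^-1.
Proof.
move=> /sg_inv /(lcs_conj x^-1).
by rewrite /lcs_eq conjgE invgM !invgK !mulgA mulgK.
Qed.

Lemma lcs_eq_commute j x u : (0 < j)%N -> lcs G j u ->
  lcs_eq j.+1 (u * x) (x * u).
Proof.
by move=> j0 hu; rewrite /lcs_eq (commgC x u) mulKg; apply: lcs_comm.
Qed.

Lemma lcs_eq_conj j x u : (0 < j)%N -> lcs G j u -> lcs_eq j.+1 u (u ^ x).
Proof. by move=> j0 hu; apply: (lcs_comm' x j0 hu). Qed.

Lemma commMg x u y : [~ x * u, y] = [~ x, y] ^ u * [~ u, y].
Proof. by rewrite !commgEl !conjMg !conjVg !conjgE !invgM !invgK !mulgA !mulgK.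
  Qed.

Lemma commgM x y u : [~ x, y * u] = [~ x, u] * [~ x, y] ^ u.
Proof. by rewrite -(invgR (y * u)) commMg invgM -conjVg !invgR. Qed.

(** With [x' = x * u], the commutator becomes [[~ x, y] ^ u * [~ u, y]]; for [u] in the [j]-th term,
    both the conjugation and the second factor change it only by the next term. *)
Lemma lcs_eq_commgl j x x' y : (0 < j)%N -> lcs_eq j x x' ->
  lcs_eq j.+1 [~ x, y] [~ x', y].
Proof.
move=> j0; have -> : x' = x * (x^-1 * x') by rewrite mulVKg.
rewrite /lcs_eq mulKg; move: (x^-1 * x') => u hu; rewrite commMg.
rewrite -/(lcs_eq _ _ _) -[X in lcs_eq _ X _]mulg1; apply: lcs_eq_mul.
  have -> : [~ x, y] ^ u = [~ x, y] * [~ [~ x, y], u].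
    by rewrite (commgEl [~ x, y]) mulVKg.
  by rewrite /lcs_eq mulKg; apply: lcs_comm.
by rewrite /lcs_eq invg1 mul1g; apply: lcs_comm'.
Qed.

Lemma lcs_eq_comm j x x' y y' : (0 < j)%N -> lcs_eq j x x' -> lcs_eq j y y' ->
  lcs_eq j.+1 [~ x, y] [~ x', y'].
Proof.
move=> j0 hx hy; apply: lcs_eq_trans (lcs_eq_commgl y j0 hx) _.
by rewrite -(invgR y) -(invgR y'); apply/lcs_eq_inv/lcs_eq_commgl.
Qed.

Lemma lcs_exp j x n : lcs G j x -> lcs G j (x ^+ n).
Proof.
by move=> hx; elim: n => [|m hm]; rewrite ?expgS; [apply: sg_one|apply: sg_mul].
Qed.

(** Modulo the term [j.+2], the map [[~ x, -]] is additive on the [j]-th term: in [commgM] the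
    conjugation acts on an element of the term [j.+1]. *)
Lemma lcs_eq_comm_exp j x y n : (0 < j)%N -> lcs G j y ->
  lcs_eq j.+2 ([~ x, y] ^+ n) [~ x, y ^+ n].
Proof.
move=> j0 hy; have hc := lcs_comm x j0 hy.
elim: n => [|n IH]; first by rewrite !expg0 commg1; apply: lcs_eq_refl.
rewrite expgS [y ^+ n.+1]expgSr commgM.
move: hc IH; set d := commg x y; set e := commg x (y ^+ n) => hc IH.
apply: lcs_eq_mul; first exact: lcs_eq_refl.
apply: lcs_eq_trans IH _; apply: lcs_eq_conj => //; apply: lcs_comm => //.
exact: lcs_exp.
Qed.

(** An element of the [j]-th term is central modulo the next one, so powers distribute over the
    product. *)
Lemma lcs_eq_expM j x y n : (0 < j)%N -> lcs G j x ->
  lcs_eq j.+1 ((x * y) ^+ n) (x ^+ n * y ^+ n).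
Proof.
move=> j0 hx; elim: n => [|n IH].
  by rewrite !expg0 mulg1; apply: lcs_eq_refl.
rewrite expgS (expgS x) (expgSr y) -mulgA.
apply: (@lcs_eq_trans _ _ (x * ((x ^+ n * y ^+ n) * y))); last first.
  by rewrite !mulgA; apply: lcs_eq_refl.
apply: lcs_eq_mul; first exact: lcs_eq_refl.
apply: (@lcs_eq_trans _ _ (y * (x ^+ n * y ^+ n))).
  by apply: lcs_eq_mul => //; apply: lcs_eq_refl.
rewrite -[X in lcs_eq _ _ X]mulgA -expgSr expgS !mulgA; apply: lcs_eq_mul;
  last exact: lcs_eq_refl.
by apply: lcs_eq_sym; apply: lcs_eq_commute => //; apply: lcs_exp.
Qed.

Lemma lcs_eq_lcs j x y : lcs_eq j x y -> lcs G j x -> lcs G j y.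
Proof. by move=> h hx; have := sg_mul hx h; rewrite mulVKg. Qed.

End LowerCentralSeries.

Section Homomorphisms.
Context (G H : groupType) (f : {multiplicative G -> H}).
Local Open Scope group_scope.

Lemma hom1 : f 1 = 1.
Proof. by apply: (mulgI (f 1)); rewrite -gmulfM !mulg1. Qed.

Lemma homV x : f x^-1 = (f x)^-1.
Proof. by apply: (mulgI (f x)); rewrite -gmulfM !mulgV hom1. Qed.

Lemma homX x n : f (x ^+ n) = f x ^+ n.
Proof. by elim: n => [|n IH]; rewrite ?expg0 ?hom1 // !expgS gmulfM IH. Qed.

Lemma homR x y : f [~ x, y] = [~ f x, f y].
Proof. by rewrite !commgEl !conjgE !gmulfM !homV. Qed.

Lemma hom_prod (I : Type) (r : seq I) (F : I -> G) :
  f (\prod_(i <- r) F i) = \prod_(i <- r) f (F i).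
Proof. by elim: r => [|i r IH];
  rewrite ?big_nil ?hom1 // !big_cons gmulfM IH. Qed.

Lemma hom_lcs j x : lcs G j x -> lcs H j (f x).
Proof.
elim: j x => // [[|j]] // IH; apply: (generated_ind (P := fun x =>
  lcs H j.+2 (f x))).
- by rewrite hom1; apply: sg_one.
- by move=> a b ha hb; rewrite gmulfM; apply: sg_mul.
- by move=> a ha; rewrite homV; apply: sg_inv.
- by move=> _ [a [b [hb ->]]]; rewrite homR; apply: lcs_comm => //; apply: IH.
Qed.

Lemma hom_lcs_eq j x y : lcs_eq j x y -> lcs_eq j (f x) (f y).
Proof. by rewrite /lcs_eq -homV -gmulfM; apply: hom_lcs. Qed.

End Homomorphisms.

Section Iterates.
Context (G : groupType) (f : {multiplicative G -> G}) (k : nat).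
Local Open Scope group_scope.

Lemma iter_homM : {morph iter k f : x y / x * y}.
Proof. by move=> x y; elim: k => //= n ->; rewrite gmulfM. Qed.

HB.instance Definition _ := isMultiplicative.Build G G (iter k f) iter_homM.

Definition iter_hom : {multiplicative G -> G} := iter k f.

End Iterates.

(** * Endomorphisms of torsion-free nilpotent groups *)

Section TorsionFree.
Context (G : groupType) (f : {multiplicative G -> G}).
Local Open Scope group_scope.

(* Induction on [j]: [f [a,b] ^ N] is congruent to [[f a, f b ^ N]]. *)
Lemma hom_isolator_lcs : (forall x, isolator 2 (f x)) ->
  forall j, (0 < j)%N -> forall y, lcs G j y -> isolator j.+1 (f y).
Proof.
move=> hf; elim=> // [[|j] IH] _ // y hy.
(* Membership in the term itself is carried through the induction on [y], because [lcs_eq_expM]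
   needs it to split powers of a product. *)
suff [] : lcs G j.+2 (f y) /\ isolator j.+3 (f y) by [].
move: y hy; apply: generated_ind.
- by split; rewrite hom1; [apply: sg_one | exists 1%N => //; rewrite expg1;
    apply: sg_one].
- move=> a b [la [n n0 ha]] [lb [m m0 hb]]; rewrite gmulfM; split;
    first exact: sg_mul.
  exists (n * m)%N; first by rewrite muln_gt0 n0.
  apply: (lcs_eq_lcs (lcs_eq_sym (lcs_eq_expM _ _ _ la))) => //.
  apply: sg_mul; first by rewrite expgnA; apply: lcs_exp.
  by rewrite mulnC expgnA; apply: lcs_exp.
- move=> a [la [n n0 ha]]; rewrite homV; split; first exact: sg_inv.
  by exists n => //; rewrite expVgn; apply: sg_inv.
- move=> _ [a [b [hb ->]]]; split; first by apply: hom_lcs; apply: lcs_comm.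
  have [n n0 hn] := IH isT b hb; exists n => //.
  rewrite homR; apply: (lcs_eq_lcs (lcs_eq_sym (lcs_eq_comm_exp _ _ _ _))) =>
    //.
    exact: hom_lcs.
  exact: lcs_comm.
Qed.

(** Each application of [f] raises the index of the isolator by one, so some power of [iter c f x]
    lies in the trivial term [c.+1], and torsion-freeness concludes. *)
Lemma iter_trivial : torsion_free G -> nilpotent_group G ->
  (forall x, isolator 2 (f x)) -> exists m, forall x, iter m f x = 1.
Proof.
move=> tf [c hc] hf; exists c => x.
suff [n n0 hn] : isolator c.+1 (iter c f x) by apply: (tf _ n) => //; apply: hc.
elim: (c) => [|j [n n0 hn]]; first by exists 1%N.
have [m m0 hm] := hom_isolator_lcs hf (ltn0Sn j) hn.
exists (n * m)%N; first by rewrite muln_gt0 n0.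
by rewrite /= expgnA -homX.
Qed.

End TorsionFree.

(** * Word length *)

Section WordLengthTheory.
Context (G : groupType) (S : seq G).
Hypothesis genS : generates S.
Local Open Scope group_scope.

Definition letters := S ++ [seq y^-1 | y <- S].

Lemma lettersV x : x \in letters -> x^-1 \in letters.
Proof.
rewrite !mem_cat => /orP[xS|/mapP[y yS ->]]; last by rewrite invgK yS.
by rewrite (map_f (fun y => y^-1)) ?orbT.
Qed.

Lemma word_exists x : exists m, word_of_size S x m.
Proof.
suff [w [hw <-]] : exists w : seq G, {subset w <= letters} /\
  \prod_(y <- w) y = x.
  by exists (size w), w.
have := genS x; move: x; apply: generated_ind.
- by exists [::]; rewrite big_nil.
- move=> x y [w [hw <-]] [w' [hw' <-]]; exists (w ++ w'); rewrite big_cat;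
    split=> //.
  by move=> z; rewrite mem_cat => /orP[/hw|/hw'].
- move=> x [w [hw <-]]; exists (rev [seq y^-1 | y <- w]); split.
    by move=> z; rewrite mem_rev => /mapP[y /hw yw ->]; apply: lettersV.
  by rewrite -map_rev big_map prodgV revK.
- move=> x xS; exists [:: x]; rewrite big_seq1; split=> // y;
    rewrite inE => /eqP->.
  by rewrite mem_cat xS.
Qed.

Lemma word_length_word x : word_of_size S x (word_length S x).
Proof.
rewrite /word_length; case: pselect => [ex|[]]; last first.
  by have [m hm] := word_exists x; exists m; apply/asboolP.
by case: ex_minnP => m /asboolP.
Qed.

Lemma word_length_min x m : word_of_size S x m -> (word_length S x <= m)%N.
Proof.
move=> hm; rewrite /word_length; case: pselect => // ex.
by case: ex_minnP => n _; apply; apply/asboolP.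
Qed.

Lemma word_length_ind (P : nat -> G -> Prop) :
  P 0%N 1 -> (forall x m y, x \in letters -> P m y -> P m.+1 (x * y)) ->
  forall x, P (word_length S x) x.
Proof.
move=> P0 PS x; have [w [<- hw <-]] := word_length_word x.
elim: w hw => [|y w IH] hw; first by rewrite big_nil.
rewrite big_cons; apply: PS; first by apply: hw; rewrite inE eqxx.
by apply: IH => z zw; apply: hw; rewrite inE zw orbT.
Qed.

Lemma word_length1 : word_length S 1 = 0%N.
Proof.
apply/eqP; rewrite -leqn0; apply: word_length_min.
by exists [::]; rewrite big_nil.
Qed.

Lemma word_lengthM x y :
  (word_length S (x * y) <= word_length S x + word_length S y)%N.
Proof.
apply: word_length_min.
have [w [<- hw <-]] := word_length_word x.
have [w' [<- hw' <-]] := word_length_word y.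
exists (w ++ w'); rewrite size_cat big_cat; split=> //.
by move=> z; rewrite mem_cat => /orP[/hw|/hw'].
Qed.

Lemma word_lengthV x : (word_length S x^-1 <= word_length S x)%N.
Proof.
apply: word_length_min.
have [w [<- hw <-]] := word_length_word x.
exists (rev [seq y^-1 | y <- w]); rewrite size_rev size_map; split=> //.
  by move=> z; rewrite mem_rev => /mapP[y /hw yw ->]; apply: lettersV.
by rewrite -map_rev big_map prodgV revK.
Qed.

Lemma word_length_letter x : x \in letters -> (word_length S x <= 1)%N.
Proof.
move=> xS; apply: word_length_min; exists [:: x]; rewrite big_seq1;
  split=> // y.
by rewrite inE => /eqP->.
Qed.

Lemma word_length_zpowg x m : (word_length S (zpowg x m) <= `|m| * word_length
  S x)%N.
Proof.
have hX n : (word_length S (x ^+ n) <= n * word_length S x)%N.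
  elim: n => [|n IH]; first by rewrite expg0 word_length1.
  by rewrite expgS (leq_trans (word_lengthM _ _)) // mulSn leq_add2l.
by case: m => n /=; rewrite ?absz_nat // (leq_trans (word_lengthV _)).
Qed.

Lemma word_length_prod (I : Type) (r : seq I) (F : I -> G) :
  (word_length S (\prod_(i <- r) F i)%g <= \sum_(i <- r) word_length S (F i))%N.
Proof.
elim: r => [|i r IH]; first by rewrite !big_nil word_length1.
by rewrite !big_cons (leq_trans (word_lengthM _ _)) // leq_add2l.
Qed.

End WordLengthTheory.

Lemma mem_letters_of (G : groupType) (S : seq G) x : x \in S -> x \in letters S.
Proof. by move=> xS; rewrite mem_cat xS. Qed.

(** * Growth of endomorphisms of nilpotent groups *)

(** Takes the maximum of finitely many bounds; it turns constants depending on a generator into a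
    single one. *)
Lemma uniform_bound (R : realType) (T : eqType) (s : seq T) (P : T -> R ->
  Prop) :
  (forall x b b', b <= b' -> P x b -> P x b') ->
  (forall x, x \in s -> exists b, P x b) ->
  exists2 b, 0 <= b & forall x, x \in s -> P x b.
Proof.
move=> mono; elim: s => [|x s IH] h; first by exists 0.
have [|b b0 hb] := IH; first by move=> y ys; apply: h; rewrite inE ys orbT.
have [b' hb'] := h x (mem_head _ _).
exists (Num.max b b'); first by rewrite le_max b0.
move=> y; rewrite inE => /orP[/eqP->|/hb hy].
  by apply: mono hb'; rewrite le_max lexx orbT.
by apply: mono hy; rewrite le_max lexx.
Qed.

Lemma exists_exp_lt (R : realType) (a e : R) : 0 <= a -> a < 1 -> 0 < e ->
  exists2 p, (0 < p)%N & a ^+ p <= e.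
Proof.
move=> a0 a1 e0.
have /cvgrPdist_le /(_ e e0) [N _ hN] : (fun n => a ^+ n) @ \oo --> (0 : R).
  by apply: cvg_expr; rewrite ger0_norm.
exists N.+1 => //; have := hN N.+1 (leqnSn N).
by rewrite sub0r normrN ger0_norm ?exprn_ge0.
Qed.

Section Growth.
Context (R : realType) (G : groupType) (S : seq G) (phi : {multiplicative G ->
  G}).
Hypothesis genS : generates S.

Local Notation len x := ((word_length S x)%:R : R).

(** A length bound in the quotient by the [j]-th term, expressed through a representative [w] in
    place of the quotient group. *)
Definition approx j k (b : R) x := exists2 w, lcs_eq j w (iter k phi x) &
  len w <= b.

Lemma approx_le j k b b' x : b <= b' -> approx j k b x -> approx j k b' x.
Proof. by move=> bb' [w h hb]; exists w => //; apply: le_trans bb'. Qed.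

Lemma approx1 j k : approx j k 0 1%g.
Proof.
exists 1%g; last by rewrite word_length1.
by rewrite (hom1 (iter_hom phi k)); apply: lcs_eq_refl.
Qed.

Lemma approxM j k b b' x y :
  approx j k b x -> approx j k b' y -> approx j k (b + b') (x * y)%g.
Proof.
move=> [w hw lw] [w' hw' lw']; exists (w * w')%g.
  by rewrite iter_homM; apply: lcs_eq_mul.
by apply: le_trans (lerD lw lw'); rewrite -natrD ler_nat word_lengthM.
Qed.

Lemma approxV j k b x : approx j k b x -> approx j k b (x^-1)%g.
Proof.
move=> [w hw lw]; exists (w^-1)%g.
  by rewrite (homV (iter_hom phi k)); apply: lcs_eq_inv.
by apply: le_trans lw; rewrite ler_nat word_lengthV.
Qed.

Lemma approx_word j k b x : (forall s, s \in S -> approx j k b s) ->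
  approx j k (len x * b) x.
Proof.
move=> h.
apply: (word_length_ind genS (P := fun m x => approx j k (m%:R * b) x)).
  by rewrite mulr0n mul0r; apply: approx1.
move=> s m y; rewrite mem_cat -natr1 addrC mulrDl mul1r => sS hy.
apply: approxM hy; case/orP: sS => [/h //|/mapP[t /h ht ->]].
exact: approxV.
Qed.

(** A commutator modulo the term [j.+1] depends on its entries only modulo the [j]-th term, so
    [[~ w, w']] is the approximation; each of [w], [w'] occurs in it twice, whence the factor 2. *)
Lemma approx_comm j k b b' x y : (0 < j)%N ->
  approx j k b x -> approx j k b' y -> approx j.+1 k (2 * (b + b')) [~ x, y]%g.
Proof.
move=> j0 [w hw lw] [w' hw' lw']; exists [~ w, w']%g.
  by rewrite (homR (iter_hom phi k)); apply: lcs_eq_comm.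
have le_comm : (word_length S [~ w, w']%g <=
    word_length S w + (word_length S w' + (word_length S w + word_length S
      w')))%N.
  rewrite commgEl conjgE; apply: leq_trans (word_lengthM genS _ _) _.
  apply: leq_add; first exact: word_lengthV.
  apply: leq_trans (word_lengthM genS _ _) _.
  apply: leq_add; first exact: word_lengthV.
  exact: word_lengthM.
apply: (@le_trans _ _ (len w + (len w' + (len w + len w')))).
  by rewrite -!natrD ler_nat.
lra.
Qed.

Lemma hom_lipschitz : exists2 K : R, 1 <= K &
  forall x, len (phi x) <= K * len x.
Proof.
have [|s _|b b0 hb] := @uniform_bound R _ S (fun s b => len (phi s) <= b).
- by move=> x b b' bb' /le_trans; apply.
- by exists (len (phi s)).
exists (b + 1) => [|x]; first by rewrite lerDr.
apply: (word_length_ind genS (P := fun m x => len (phi x) <= (b + 1) * m%:R)).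
  by rewrite mulr0n mulr0 hom1 word_length1.
move=> s m y sS hy; rewrite gmulfM.
apply: (@le_trans _ _ (len (phi s) + len (phi y)));
  first by rewrite -natrD ler_nat word_lengthM.
rewrite -natr1 mulrDr mulr1 addrC; apply: lerD => //.
apply: (@le_trans _ _ b); last by rewrite lerDl.
move: sS; rewrite mem_cat => /orP[/hb //|/mapP[t /hb ht ->]].
by apply: le_trans ht; rewrite homV ler_nat word_lengthV.
Qed.

Definition growth j (r : R) x := exists C, forall k, approx j k (C * r ^+ k) x.

Section Rate.
Context (r1 r : R).
Hypotheses (r1_gt0 : 0 < r1) (r1r : r1 < r) (r_ge1 : 1 <= r).
Hypothesis growth_ab : forall x, growth 2 r1 x.

Let r0 : 0 < r. Proof. exact: lt_le_trans r_ge1. Qed.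

Lemma growth1 j : growth j r 1%g.
Proof. by exists 0 => k; rewrite mul0r; apply: approx1. Qed.

Lemma growthM j x y : growth j r x -> growth j r y -> growth j r (x * y)%g.
Proof.
by move=> [C hC] [C' hC']; exists (C + C') => k; rewrite mulrDl; apply: approxM.
Qed.

Lemma growthV j x : growth j r x -> growth j r (x^-1)%g.
Proof. by move=> [C hC]; exists C => k; apply: approxV. Qed.

Lemma growth_comm j x y : (0 < j)%N ->
  growth j r x -> growth j r y -> growth j.+1 r [~ x, y]%g.
Proof.
move=> j0 [C hC] [C' hC']; exists (2 * (C + C')) => k.
by rewrite -mulrA [(C + C') * _]mulrDl; apply: approx_comm.
Qed.

(* The generators grow, along multiples of a large [p], by a factor [r ^ p / 2]
   coming from the abelianization, up to an error term in the second term of the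
   lower central series that is already known to grow at rate [r]. *)
Lemma growth_step j : (forall x, lcs G 2 x -> growth j r x) ->
  forall x, growth j r x.
Proof.
move=> h2.
have [|s _|C C0 hC] := @uniform_bound R _ S (fun s C =>
  forall k, approx 2 k (C * r1 ^+ k) s).
- move=> x b b' bb' h k; apply: approx_le (h k).
  by rewrite ler_wpM2r // exprn_ge0 // ltW.
- exact: growth_ab.
(* [p] is chosen so large that [C * r1 ^+ p <= r ^+ p / 2]; the [+ 1] covers [C = 0]. *)
have [|||p p0 hp] := @exists_exp_lt R (r1 / r) (2 * (C + 1))^-1.
- by rewrite divr_ge0 // ltW.
- by rewrite ltr_pdivrMr // mul1r.
- by rewrite invr_gt0 mulr_gt0 // ltr_wpDl.
have {}hp : C * r1 ^+ p <= r ^+ p / 2.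
  move: hp; rewrite expr_div_n ler_pdivrMr ?exprn_gt0 // => hp.
  have hC2 : C * (2 * (C + 1))^-1 <= 2^-1.
    by rewrite ler_pdivrMr; [rewrite mulrA mulVf ?mul1r; lra | lra].
  apply: le_trans (ler_wpM2l C0 hp) _.
  by rewrite mulrA [leRHS]mulrC ler_wpM2r // exprn_ge0 // ltW.
have [|s sS|D D0 hD] := @uniform_bound R _ S (fun s D => exists2 w : G,
    len w <= r ^+ p / 2 & forall k, approx j k (D * r ^+ k) (w^-1 * iter p phi
      s)%g).
- move=> x b b' bb' [w lw h]; exists w => // k; apply: approx_le (h k).
  by rewrite ler_wpM2r // exprn_ge0 // ltW.
- have [w hw lw] := hC s sS p.
  have [D hD] := h2 _ hw; exists D, w => //.
  exact: le_trans hp.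
(* [M] satisfies [r ^+ p / 2 * M + D <= M * r ^+ p], given [1 <= r ^+ p]; this closes the induction
   on multiples of [p]. *)
pose M := 1 + 2 * D.
have hM k s : s \in S -> approx j (k * p) (M * r ^+ (k * p)) s.
  elim: k s => [|k IH] s sS.
    rewrite mul0n expr0 mulr1; exists s; first exact: lcs_eq_refl.
    apply: (@le_trans _ _ 1); last by rewrite /M; lra.
    by rewrite lern1 word_length_letter // mem_letters_of.
  have [w lw hw] := hD s sS.
  have [u hu lu] := approx_word w IH.
  have [v hv lv] := hw (k * p)%N.
  exists (u * v)%g.
    rewrite mulSn addnC iterD -[iter p phi s](mulVKg w) iter_homM.
    exact: lcs_eq_mul.
  apply: (@le_trans _ _ (len u + len v));
    first by rewrite -natrD ler_nat word_lengthM.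
  apply: le_trans (lerD lu lv) _.
  have rk : 0 <= r ^+ (k * p) by rewrite exprn_ge0 // ltW.
  have rp : 1 <= r ^+ p by rewrite exprn_ege1.
  rewrite mulrA -mulrDl mulSn exprD mulrA ler_wpM2r //.
  apply: (@le_trans _ _ (r ^+ p / 2 * M + D)).
    by rewrite lerD2r ler_wpM2r // /M; lra.
  rewrite /M; nra.
have [K K1 hK] := hom_lipschitz.
have hKk q w : len (iter q phi w) <= K ^+ q * len w.
  elim: q => [|q IH] /=; first by rewrite expr0 mul1r.
  apply: le_trans (hK _) _; rewrite exprS -mulrA ler_wpM2l //.
  by apply: le_trans K1.
move=> x; apply: generated_ind (genS x);
  [exact: growth1|exact: growthM|exact: growthV|].
(* The remaining [k %% p] iterations cost at most the factor [K ^+ p]. *)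
move=> s sS; exists (K ^+ p * M) => k; rewrite (divn_eq k p) addnC.
have [w hw lw] := hM (k %/ p)%N s sS.
exists (iter (k %% p) phi w); first by rewrite iterD;
  apply: (hom_lcs_eq (iter_hom phi _)).
apply: le_trans (hKk _ _) _.
have K0 n : 0 <= K ^+ n by rewrite exprn_ge0 // (le_trans _ K1).
have M0 : 0 <= M by rewrite /M; lra.
have rk n : 0 <= r ^+ n by rewrite exprn_ge0 // ltW.
apply: le_trans (ler_wpM2l (K0 _) lw) _.
rewrite -mulrA; apply: ler_pM => //; first by rewrite mulr_ge0.
  by rewrite ler_weXn2l // ltnW // ltn_pmod.
by rewrite ler_wpM2l // ler_weXn2l // leq_addl.
Qed.

(** [growth_comm] raises the index by one on commutators, hence on the whole commutator subgroup,
    and [growth_step] extends this to all of [G]; the start is the abelianization. *)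
Lemma growth_lcs j x : growth j.+2 r x.
Proof.
elim: j x => [|j IH] x.
  have [C hC] := growth_ab x; have C0 : 0 <= C.
    have [w _ hw] := hC 0%N; rewrite expr0 mulr1 in hw.
    exact: le_trans hw.
  exists C => k; apply: approx_le (hC k).
  by rewrite ler_wpM2l //; apply: lerXn2r; rewrite ?nnegrE ltW.
apply: growth_step => {}x; apply: generated_ind;
  [exact: growth1|exact: growthM|exact: growthV|].
by move=> _ [a [b [_ ->]]]; apply: growth_comm.
Qed.

Lemma growth_word_length : nilpotent_group G ->
  forall x, exists C, forall k, len (iter k phi x) <= C * r ^+ k.
Proof.
move=> [c hc] x; have [C hC] := growth_lcs c x; exists C => k.
have [w hw lw] := hC k; have /hc := lcsS hw.
by move=> /(congr1 (fun y => w * y)%g); rewrite mulVKg mulg1 => ->.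
Qed.

End Rate.
End Growth.

(** * Abelianization and coordinates modulo torsion *)

Section AbelianizationZmodule.
Context (G : groupType).

Lemma ab_mulC : commutative (@ab_mul G).
Proof.
move=> x y; rewrite -[x]ab_reprP -[y]ab_reprP !ab_mulE; apply/ab_projP.
by rewrite invgM -mulgA -commgEl; apply: derived_commg.
Qed.

HB.instance Definition _ := @GRing.isZmodule.Build (abelianization G)
  (ab_proj 1%g) (@ab_inv G) (@ab_mul G) (@ab_mulA G) ab_mulC (@ab_mul1 G)
    (@ab_mulV G).

Lemma ab_projD (x y : G) : ab_proj (x * y)%g = ab_proj x + ab_proj y.
Proof. by rewrite ab_projM. Qed.

Lemma ab_proj1 : ab_proj (1%g : G) = 0.
Proof. by []. Qed.

Lemma ab_projN (x : G) : ab_proj (x^-1)%g = - ab_proj x.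
Proof. by rewrite -ab_invE. Qed.

Lemma ab_projXn (x : G) n : ab_proj (x ^+ n)%g = ab_proj x *+ n.
Proof. by elim: n => [|n IH] //; rewrite expgS ab_projD IH mulrS. Qed.

Lemma ab_proj_zpowg (x : G) m : ab_proj (zpowg x m) = ab_proj x *~ m.
Proof. by case: m => n /=; rewrite ?ab_projN ab_projXn. Qed.

Lemma ab_proj_prod (I : Type) (r : seq I) (F : I -> G) :
  ab_proj (\prod_(i <- r) F i)%g = \sum_(i <- r) ab_proj (F i).
Proof. by elim: r => [|i r IH]; rewrite ?big_nil // !big_cons ab_projD IH. Qed.

Lemma ab_proj_eq (x y : G) : ab_proj x = ab_proj y <-> lcs_eq 2 x y.
Proof. exact: ab_projP. Qed.

Definition tors (a : abelianization G) := exists2 n, (0 < n)%N & a *+ n = 0.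

Lemma isolator2P (x : G) : isolator 2 x <-> tors (ab_proj x).
Proof.
have h n : lcs G 2 (x ^+ n)%g <-> ab_proj x *+ n = 0.
  rewrite -ab_projXn -ab_proj1; split=> [hx|/esym /ab_proj_eq].
    by apply/esym/ab_proj_eq; rewrite /lcs_eq invg1 mul1g.
  by rewrite /lcs_eq invg1 mul1g.
by split=> -[n n0 /h hn]; exists n.
Qed.

Lemma tors0 : tors 0.
Proof. by exists 1%N. Qed.

Lemma torsD a b : tors a -> tors b -> tors (a + b).
Proof.
move=> [n n0 hn] [m m0 hm]; exists (n * m)%N; first by rewrite muln_gt0 n0.
by rewrite mulrnDl mulrnA hn mul0rn add0r mulnC mulrnA hm mul0rn.
Qed.

Lemma torsN a : tors a -> tors (- a).
Proof. by move=> [n n0 hn]; exists n; rewrite ?mulNrn ?hn ?oppr0. Qed.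

End AbelianizationZmodule.

Section Coordinates.
Context (G : groupType) (k : nat) (s : 'I_k -> G).
Hypothesis basis : isolator_basis 1 s.
Local Open Scope ring_scope.

Definition comb (v : 'cV[int]_k) : abelianization G :=
  \sum_i ab_proj (s i) *~ v i ord0.

Lemma combD u v : comb (u + v) = comb u + comb v.
Proof.
by rewrite /comb -big_split; apply: eq_bigr => i _; rewrite mxE mulrzDr.
Qed.

Lemma combN v : comb (- v) = - comb v.
Proof.
by rewrite /comb -sumrN; apply: eq_bigr => i _; rewrite mxE mulrNz.
Qed.

Lemma comb0 : comb 0 = 0.
Proof. by rewrite /comb big1 // => i _; rewrite mxE. Qed.

Lemma isolator2_comb (v : 'cV[int]_k) x :
  isolator 2 ((\prod_(i < k) zpowg (s i) (v i ord0))^-1 * x)%g <->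
  tors (ab_proj x - comb v).
Proof.
apply: iff_trans (isolator2P _) _.
rewrite ab_projD ab_projN ab_proj_prod addrC.
by rewrite (eq_bigr (fun i => ab_proj (s i) *~ v i ord0)) // => i _;
  rewrite ab_proj_zpowg.
Qed.

Lemma abcoord_exists x : exists! v, tors (ab_proj x - comb v).
Proof.
have [_ /(_ x)] := basis; case; first by exists 1%N.
move=> v [/isolator2_comb hv uv]; exists v; split=> // u hu.
by apply: uv; apply/isolator2_comb.
Qed.

(** The homomorphism from [G] to [Z ^ k] whose kernel is the isolator of the second term; uniqueness
    in [isolator_basis] makes the choice additive. *)
Definition abcoord x : 'cV[int]_k := projT1 (cid (abcoord_exists x)).

Lemma abcoordP x : tors (ab_proj x - comb (abcoord x)).
Proof. by rewrite /abcoord; case: cid => v []. Qed.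

Lemma abcoordE x v : tors (ab_proj x - comb v) -> abcoord x = v.
Proof. by rewrite /abcoord; case: cid => u [] _ /=; apply. Qed.

Lemma abcoordM x y : abcoord (x * y)%g = abcoord x + abcoord y.
Proof.
apply: abcoordE; rewrite ab_projD combD opprD addrACA.
by apply: torsD; apply: abcoordP.
Qed.

Lemma abcoordV x : abcoord (x^-1)%g = - abcoord x.
Proof.
apply: abcoordE; rewrite ab_projN combN -opprD.
by apply: torsN; apply: abcoordP.
Qed.

Lemma abcoord1 : abcoord 1%g = 0.
Proof. by apply: abcoordE; rewrite ab_proj1 comb0 subr0; apply: tors0. Qed.

Lemma abcoord_isolator x : abcoord x = 0 -> isolator 2 x.
Proof.
move=> h; apply/isolator2P; have := abcoordP x; rewrite h.
by rewrite comb0 subr0.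
Qed.

Lemma abcoord_ab x y : ab_proj x = ab_proj y -> abcoord x = abcoord y.
Proof. by move=> xy; apply: abcoordE; rewrite xy; apply: abcoordP. Qed.

Lemma abcoord_basis l : abcoord (s l) = \col_i (i == l)%:R.
Proof.
apply: abcoordE; rewrite /comb (bigD1 l) //= big1 => [|i il]; rewrite mxE.
  by rewrite eqxx addr0 mulr1z subrr; apply: tors0.
by rewrite (negPf il) mulr0z.
Qed.

Context (phi : {multiplicative G -> G}) (D1 : 'M[int]_k).
Hypothesis D1P : induced_matrix phi 1 s D1.

Lemma abcoord_phi_basis l : abcoord (phi (s l)) = col l D1.
Proof.
apply: abcoordE; apply/isolator2_comb; have := D1P l.
by rewrite (eq_bigr (fun i => zpowg (s i) (col l D1 i ord0))) // => i _;
  rewrite mxE.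
Qed.

Lemma abcoord_zpowg x m : abcoord (zpowg x m) = m *: abcoord x.
Proof.
have hX n : abcoord (x ^+ n)%g = (n%:Z) *: abcoord x.
  elim: n => [|n IH]; first by rewrite abcoord1 scale0r.
  by rewrite expgS abcoordM IH intS scalerDl scale1r.
by case: m => n /=; rewrite ?abcoordV hX // NegzE scaleNr.
Qed.

Lemma abcoord_prod (I : Type) (r : seq I) (F : I -> G) :
  abcoord (\prod_(i <- r) F i)%g = \sum_(i <- r) abcoord (F i).
Proof.
elim: r => [|i r IH]; first by rewrite !big_nil abcoord1.
by rewrite !big_cons abcoordM IH.
Qed.

(** [x] differs from the product [y] of powers of basis elements by an element of the isolator,
    which [phi] preserves; on [y] the claim is linear in the columns of [D1]. *)
Lemma abcoord_phi x : abcoord (phi x) = D1 *m abcoord x.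
Proof.
pose y := (\prod_(i < k) zpowg (s i) (abcoord x i ord0))%g.
have [n n0 hn] : isolator 2 (y^-1 * x)%g by apply/isolator2_comb;
  apply: abcoordP.
have -> : abcoord (phi x) = abcoord (phi y).
  apply/eqP; rewrite -subr_eq0 addrC -abcoordV -homV -abcoordM -gmulfM.
  suff -> : abcoord (phi (y^-1 * x)%g) = 0 by [].
  apply: abcoordE; rewrite comb0 subr0; apply/isolator2P; exists n => //.
  by rewrite -homX; apply: hom_lcs.
rewrite /y hom_prod abcoord_prod; apply/colP => i; rewrite summxE mxE.
apply: eq_bigr => j _.
have -> : phi (zpowg (s j) (abcoord x j ord0)) = zpowg (phi (s j)) (abcoord x j
  ord0).
  by case: (abcoord x j ord0) => m /=; rewrite ?homV homX.
by rewrite abcoord_zpowg abcoord_phi_basis !mxE mulrC.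
Qed.

End Coordinates.

(** * Lower bounds on growth from seminorms *)

Section MaxLength.
Context (R : realType) (G : groupType) (S : seq G) (f : {multiplicative G ->
  G}).
Hypothesis genS : generates S.
Local Notation len x := ((word_length S x)%:R : R).

Section Seminorm.
Variable nu : G -> R.
Hypotheses (nu1 : nu 1%g = 0) (nuV : forall x, nu (x^-1)%g = nu x).
Hypothesis (nuM : forall x y, nu (x * y)%g <= nu x + nu y).

Lemma seminorm_lipschitz : exists2 K, 0 <= K & forall x, nu x <= K * len x.
Proof.
have [|s _|K K0 hK] := @uniform_bound R _ S (fun s b => nu s <= b).
- by move=> x b b' bb' /le_trans; apply.
- by exists (nu s).
exists K => //; apply: (word_length_ind genS (P := fun m x =>
  nu x <= K * m%:R)).
  by rewrite mulr0n mulr0 nu1.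
move=> s m y sS hy; apply: le_trans (nuM _ _) _.
rewrite -natr1 mulrDr mulr1 addrC; apply: lerD => //.
by move: sS; rewrite mem_cat => /orP[/hK //|/mapP[t /hK ht ->]]; rewrite nuV.
Qed.

Lemma word_length_iter m x :
  (word_length S (iter m f x) <= word_length S x * max_length f S m)%N.
Proof.
apply: (word_length_ind genS
  (P := fun n x => word_length S (iter m f x) <= n * max_length f S m)%N).
  by rewrite (hom1 (iter_hom f m)) word_length1.
move=> s n y sS hy; rewrite iter_homM mulSn.
apply: leq_trans (word_lengthM genS _ _) (leq_add _ hy).
have h t : t \in S -> (word_length S (iter m f t) <= max_length f S m)%N.
  by move=> tS; rewrite /max_length (big_rem t) //= leq_maxl.
move: sS; rewrite mem_cat => /orP[/h //|/mapP[t /h ht ->]].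
by rewrite (homV (iter_hom f m)); apply: leq_trans (word_lengthV genS _) ht.
Qed.

(** Source of all lower bounds on growth: a seminorm [nu] is Lipschitz for word length, and
    [iter m f x] is a product of [word_length S x] images of letters under [f ^ m]. *)
Lemma max_length_lower x :
  exists2 C, 0 <= C & forall m, nu (iter m f x) <= C * (max_length f S m)%:R.
Proof.
have [K K0 hK] := seminorm_lipschitz.
exists (K * len x) => [|m]; first by rewrite mulr_ge0.
apply: le_trans (hK _) _; rewrite -mulrA ler_wpM2l // -natrM ler_nat.
exact: word_length_iter.
Qed.

End Seminorm.
End MaxLength.

Lemma iter_ab_map (G : groupType) (phi : {multiplicative G -> G}) m x :
  iter m (ab_map phi) (ab_proj x) = ab_proj (iter m phi x).
Proof. by elim: m => //= m ->; rewrite ab_mapE. Qed.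

Section AbelianizationLength.
Context (R : realType) (G : groupType) (Sab : seq (abelianization G)) (S :
  seq G).
Hypotheses (genS : generates S) (genSab : generates Sab).

Lemma ab_proj_lipschitz : exists2 K : R, 0 <= K & forall x : G,
  (word_length Sab (ab_proj x))%:R <= K * (word_length S x)%:R.
Proof.
apply: (seminorm_lipschitz genS (nu := fun x =>
  (word_length Sab (ab_proj x))%:R)).
- by rewrite word_length1.
- move=> x; congr (_%:R); apply/eqP; rewrite eqn_leq.
  have hV y : (word_length Sab (ab_proj (y^-1)%g) <= word_length Sab (ab_proj
    y))%N.
    by rewrite (homV (@ab_proj G)) word_lengthV.
  by rewrite hV -{1}[x]invgK hV.
- by move=> x y; rewrite -natrD ler_nat ab_projM word_lengthM.
Qed.

End AbelianizationLength.

(** * Coordinates and length modulo commutators *)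

Section CoordinateGrowth.
Context (R : realType) (G : groupType) (k : nat) (s : 'I_k -> G).
Hypothesis basis : isolator_basis 1 s.
Local Notation abcoord := (abcoord basis).

Implicit Types v : 'cV[int]_k.

Definition l1norm (v : 'cV[int]_k) : R := \sum_i `|(v i ord0)%:~R|.

Lemma l1norm_ge0 v : 0 <= l1norm v.
Proof. by apply: sumr_ge0. Qed.

Lemma l1norm0 : l1norm 0 = 0.
Proof. by rewrite /l1norm big1 // => i _; rewrite mxE normr0. Qed.

Lemma l1normN v : l1norm (- v) = l1norm v.
Proof. by apply: eq_bigr => i _; rewrite mxE intrN normrN. Qed.

Lemma l1normD u v : l1norm (u + v) <= l1norm u + l1norm v.
Proof.
by rewrite /l1norm -big_split; apply: ler_sum => i _;
  rewrite mxE intrD ler_normD.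
Qed.

Lemma l1norm_entry v i : `|(v i ord0)%:~R| <= l1norm v.
Proof. by rewrite /l1norm (bigD1 i) //= lerDl sumr_ge0. Qed.

Lemma l1norm_le v b : (forall i, `|(v i ord0)%:~R| <= b) ->
  l1norm v <= k%:R * b.
Proof.
move=> h; apply: le_trans (ler_sum _ (fun i _ => h i)) _.
by rewrite sumr_const card_ord mulr_natl.
Qed.

Section Generated.
Context (S : seq G).
Hypothesis genS : generates S.
Local Notation len x := ((word_length S x)%:R : R).

Definition residue x : G :=
  ((\prod_(i < k) zpowg (s i) (abcoord x i ord0))^-1 * x)%g.

Lemma ab_residue x : ab_proj (residue x) = ab_proj x - comb s (abcoord x).
Proof.
rewrite ab_projD ab_projN ab_proj_prod addrC /comb.
by congr (_ - _); apply: eq_bigr => i _; rewrite ab_proj_zpowg.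
Qed.

(* The torsion of the abelianization is generated by the torsion parts of the
   generators, which have a common exponent [N]. *)
Lemma ab_residue_generators : exists2 N, (0 < N)%N & forall x,
  exists2 z : 'I_(size S) -> nat, (forall i, z i < N)%N &
    ab_proj (residue x) = \sum_(i < size S) ab_proj (residue (nth 1%g S i)) *+
      z i.
Proof.
have tor x : tors (ab_proj (residue x)) by rewrite ab_residue; apply: abcoordP.
have [N N0 hN] : exists2 N, (0 < N)%N & forall i : 'I_(size S),
    ab_proj (residue (nth 1%g S i)) *+ N = 0.
  have /choice [n hn] : forall i : 'I_(size S), exists n,
      (0 < n)%N /\ ab_proj (residue (nth 1%g S i)) *+ n = 0.
    by move=> i; have [n n0 hn] := tor (nth 1%g S i); exists n.
  exists (\prod_i n i)%N; first by apply: prodn_gt0 => i; case: (hn i).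
  by move=> i; rewrite (bigD1 i) //= mulrnA (hn i).2 mul0rn.
exists N => // x.
suff [z hz] : exists z : 'I_(size S) -> int,
    ab_proj (residue x) = \sum_(i < size S) ab_proj (residue (nth 1%g S i)) *~
      z i.
  (* Integer coefficients are reduced modulo the common exponent [N], which bounds them. *)
  exists (fun i => `|(z i %% N)%Z|%N).
    by move=> i; rewrite -ltz_nat gez0_abs ?modz_ge0 ?ltz_pmod // -lt0n.
  rewrite hz; apply: eq_bigr => i _.
  rewrite {1}(divz_eq (z i) N) mulrzDr mulrC mulrzA -[_ *~ N]/(_ *+ N) hN
    mul0rz add0r.
  have h : (0 <= (z i %% N)%Z) by rewrite modz_ge0 // -lt0n.
  by rewrite -{1}(gez0_abs h).
have := genS x; move: x; apply: generated_ind.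
- by exists (fun=> 0); rewrite ab_residue abcoord1 comb0 subr0 big1.
- move=> x y [z hz] [z' hz']; exists (fun i => z i + z' i).
  rewrite ab_residue abcoordM combD ab_projD opprD addrACA -!ab_residue hz hz'.
  by rewrite -big_split; apply: eq_bigr => i _; rewrite mulrzDr.
- move=> x [z hz]; exists (fun i => - z i).
  rewrite ab_residue abcoordV combN ab_projN -opprD -ab_residue hz -sumrN.
  by apply: eq_bigr => i _; rewrite mulrNz.
- move=> x xS; have xS' : (index x S < size S)%N by rewrite index_mem.
  exists (fun i => (i == Ordinal xS')%:R).
  rewrite (bigD1 (Ordinal xS')) //= eqxx big1 => [|i /negPf ->];
    last by rewrite mulr0z.
  by rewrite nth_index // addr0.
Qed.

(** The free part is a product of powers of the [s i], of length controlled by the coordinates; the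
    torsion part has bounded length by [ab_residue_generators], which accounts for the summand 1. *)
Lemma ab_length : exists2 C, 0 <= C & forall x,
  exists2 w, lcs_eq 2 w x & len w <= C * (1 + l1norm (abcoord x)).
Proof.
have [N N0 hN] := ab_residue_generators.
pose C1 : R := \sum_i len (s i).
pose C2 : R := \sum_(i < size S) N%:R * len (residue (nth 1%g S i)).
have C10 : 0 <= C1 by apply: sumr_ge0.
have C20 : 0 <= C2 by apply: sumr_ge0 => i _; rewrite mulr_ge0.
exists (C1 + C2) => [|x]; first by rewrite addr_ge0.
have [z zN hz] := hN x.
exists ((\prod_(i < k) zpowg (s i) (abcoord x i ord0)) *
        \prod_(i < size S) (residue (nth 1%g S i) ^+ z i))%g.
  apply/ab_proj_eq; rewrite ab_projD !ab_proj_prod.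
  under [X in _ + X]eq_bigr => i _ do rewrite ab_projXn.
  under [X in X + _]eq_bigr => i _ do rewrite ab_proj_zpowg.
  by rewrite -hz ab_residue -/(comb s (abcoord x)) addrC subrK.
apply: le_trans (_ : C1 * l1norm (abcoord x) + C2 <= _); last first.
  by have := l1norm_ge0 (abcoord x); nra.
apply: (@le_trans _ _ (len (\prod_(i < k) zpowg (s i) (abcoord x i ord0))%g +
   len (\prod_(i < size S) (residue (nth 1%g S i) ^+ z i))%g)).
  by rewrite -natrD ler_nat word_lengthM.
apply: lerD.
  apply: (@le_trans _ _ (\sum_(i < k) len (zpowg (s i) (abcoord x i ord0)))).
    by rewrite -natr_sum ler_nat word_length_prod.
  rewrite mulr_suml; apply: ler_sum => i _.
  apply: (@le_trans _ _ (len (s i) * `|(abcoord x i ord0)%:~R|)).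
    rewrite -intr_norm -abszE -[X in _ * X]/(_%:R) -natrM ler_nat mulnC.
    exact: word_length_zpowg.
  by rewrite ler_wpM2l // l1norm_entry.
apply: (@le_trans _ _ (\sum_(i < size S) len (residue (nth 1%g S i) ^+ z i)%g)).
  by rewrite -natr_sum ler_nat word_length_prod.
apply: ler_sum => i _; rewrite -natrM ler_nat.
apply: leq_trans (word_length_zpowg genS _ (z i)) _.
by rewrite leq_mul2r absz_nat (ltnW (zN i)) orbT.
Qed.

End Generated.

Context (phi : {multiplicative G -> G}) (D1 : 'M[int]_k).
Hypothesis D1P : induced_matrix phi 1 s D1.

Lemma abcoord_iter m x : abcoord (iter m phi x) = D1 ^+ m *m abcoord x.
Proof.
elim: m => [|m IH] /=; first by rewrite expr0 mul1mx.
by rewrite (abcoord_phi _ D1P) IH mulmxA exprS.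
Qed.

Lemma abcoord_iter_basis m i l :
  abcoord (iter m phi (s l)) i ord0 = (D1 ^+ m) i l.
Proof.
rewrite abcoord_iter mxE (bigD1 l) //= abcoord_basis mxE eqxx mulr1 big1 ?addr0
  //.
by move=> j /negPf jl; rewrite mxE jl mulr0.
Qed.

(** As [1 <= r], the additive constant of [ab_length] is absorbed by [r ^+ m]; the coordinates of
    [phi ^ m x] are those of [x] multiplied by [D1 ^+ m]. *)
Lemma growth_abelian (S : seq G) (genS : generates S) (r C : R) :
  1 <= r -> (forall m i j, `|((D1 ^+ m) i j)%:~R| <= C * r ^+ m) ->
  forall x, growth S phi 2 r x.
Proof.
move=> r1 hC x; have [A A0 hA] := ab_length genS.
have rm m : 1 <= r ^+ m by rewrite exprn_ege1.
exists (A * (1 + k%:R * (`|C| * l1norm (abcoord x)))) => m.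
have [w hw lw] := hA (iter m phi x); exists w => //.
apply: le_trans lw _; rewrite -mulrA ler_wpM2l // mulrDl mul1r lerD // -mulrA.
apply: l1norm_le => i; rewrite abcoord_iter mxE raddf_sum.
apply: le_trans (ler_norm_sum _ _ _) _.
rewrite mulrAC [X in _ <= X]mulr_sumr; apply: ler_sum => j _.
rewrite /= intrM normrM ler_wpM2r // (le_trans (hC m i j)) //
  ler_wpM2r ?ler_norm //.
by rewrite (le_trans _ (rm m)).
Qed.

Lemma matrix_le_max_length (S : seq G) : generates S ->
  exists2 C : R, 0 <= C & forall m i j,
    `|((D1 ^+ m) i j)%:~R| <= C * (max_length phi S m)%:R.
Proof.
move=> genS.
have [|j _|C C0 hC] := @uniform_bound R _ (enum 'I_k)
  (fun j C => forall m, l1norm (abcoord (iter m phi (s j))) <= C * (max_length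
    phi S m)%:R).
- by move=> x b b' bb' h m; apply: le_trans (h m) _; rewrite ler_wpM2r.
- have [||x y|C _ hC] := @max_length_lower R G S phi genS (fun x =>
    l1norm (abcoord x)) _ _ _ (s j).
  + by rewrite abcoord1 l1norm0.
  + by move=> x; rewrite abcoordV l1normN.
  + by rewrite abcoordM l1normD.
  + by exists C.
exists C => // m i j; apply: le_trans (hC j _ m); last by rewrite mem_enum.
by rewrite -abcoord_iter_basis l1norm_entry.
Qed.

Lemma matrix_le_max_length_ab (Sab : seq (abelianization G)) : generates Sab ->
  exists2 C : R, 0 <= C & forall m i j,
    `|((D1 ^+ m) i j)%:~R| <= C * (max_length (ab_map phi) Sab m)%:R.
Proof.
move=> genS.
(* The coordinates factor through the abelianization, so evaluating them on [repr] again gives a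
   seminorm. *)
have cr x : abcoord (repr (ab_proj x)) = abcoord x by apply: abcoord_ab;
  apply: ab_reprP.
have [|j _|C C0 hC] := @uniform_bound R _ (enum 'I_k)
  (fun j C => forall m, l1norm (abcoord (iter m phi (s j))) <= C * (max_length
    (ab_map phi) Sab m)%:R).
- by move=> x b b' bb' h m; apply: le_trans (h m) _; rewrite ler_wpM2r.
- have [||x y|C _ hC] := @max_length_lower R _ Sab (ab_map phi) genS (fun x =>
    l1norm (abcoord (repr x))) _ _ _ (ab_proj (s j)).
  + by rewrite (cr 1%g) abcoord1 l1norm0.
  + by move=> x; rewrite -[x]ab_reprP -(homV (@ab_proj G)) !cr abcoordV l1normN.
  + by rewrite -[x]ab_reprP -[y]ab_reprP -ab_projM !cr abcoordM l1normD.
  + by exists C => m; have := hC m; rewrite iter_ab_map cr.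
exists C => // m i j; apply: le_trans (hC j _ m); last by rewrite mem_enum.
by rewrite -abcoord_iter_basis l1norm_entry.
Qed.

End CoordinateGrowth.

(** * Spectral radius *)

Lemma geometric_recurrence (C : numFieldType) (a b : nat -> C) (z r K : C) :
  `|z| < r -> (forall m, a m.+1 = z * a m + b m) ->
  (forall m, `|b m| <= K * r ^+ m) ->
  exists K', forall m, `|a m| <= K' * r ^+ m.
Proof.
move=> zr ha hb; have r0 : 0 <= r by rewrite ltW // (le_lt_trans _ zr).
have K0 : 0 <= K by have := hb 0; rewrite expr0 mulr1; apply: le_trans.
have d0 : 0 < r - `|z| by rewrite subr_gt0.
(* Chosen so that [|z| * K' + K <= r * K'], with [|a 0|] for the initial value. *)
pose K' := `|a 0| + K / (r - `|z|).
have K'0 : 0 <= K' by rewrite addr_ge0 // divr_ge0 // ltW.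
exists K'; elim=> [|m IH]; first by rewrite expr0 mulr1 lerDl divr_ge0 // ltW.
rewrite ha (le_trans (ler_normD _ _)) // normrM.
apply: le_trans (lerD (ler_wpM2l (normr_ge0 z) IH) (hb m)) _.
rewrite mulrA -mulrDl exprS mulrA ler_wpM2r ?exprn_ge0 //.
rewrite -lerBrDl [`|z| * _]mulrC -mulrBr mulrDl divfK ?gt_eqF // lerDr.
by rewrite mulr_ge0 // ltW.
Qed.

(* Peeling off one root of the characteristic polynomial at a time, starting
   from the Cayley-Hamilton theorem. *)
Lemma power_bound_closed (C : numClosedFieldType) n (A : 'M[C]_n.+1) (r : C) :
  (forall z, eigenvalue A z -> `|z| < r) ->
  forall i j, exists K, forall m, `|(A ^+ m) i j| <= K * r ^+ m.
Proof.
move=> hr.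
have [rs hrs] := closed_field_poly_normal (char_poly A).
have lead1 : lead_coef (char_poly A) = 1 by apply/eqP; apply: char_poly_monic.
rewrite lead1 scale1r in hrs.
have {}hr z : z \in rs -> `|z| < r.
  by move=> zrs; apply: hr; rewrite eigenvalue_root_char hrs root_prod_XsubC.
(* [M s] is the product over the roots not yet removed: zero for the full list, the identity for the
   empty one. *)
pose M s := horner_mx A (\prod_(z <- s) ('X - z%:P)).
suff : forall s, {subset s <= rs} ->
    (forall i j, exists K, forall m, `|(M s * A ^+ m) i j| <= K * r ^+ m) ->
    forall i j, exists K, forall m, `|(A ^+ m) i j| <= K * r ^+ m.
  move=> H; apply: (H rs) => // i j; exists 0 => m.
  by rewrite /M -hrs Cayley_Hamilton mul0r mxE normr0 mul0r.
elim=> [_ h i j|z s IH sub h].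
  have [K hK] := h i j; exists K => m.
  by have := hK m; rewrite /M big_nil rmorph1 mul1r.
apply: IH => [x xs|i j]; first by apply: sub; rewrite inE xs orbT.
have [K hK] := h i j.
(* Since [M (z :: s)] is [(A - z) * M s], the entries of [M s * A ^+ m] satisfy a recurrence with
   ratio [z] and inhomogeneous term from [M (z :: s) * A ^+ m]. *)
apply: (geometric_recurrence (hr z _) _ hK) => [|m]; first by apply: sub;
  rewrite mem_head.
have -> : M (z :: s) = (A - z%:M) * M s.
  by rewrite /M big_cons rmorphM rmorphB /= horner_mx_X horner_mx_C.
have hc : M s * A = A * M s by apply: comm_horner_mx.
rewrite -!mulmxE in hc *; rewrite exprS -mulmxE mulmxA hc !mulmxBl.
by rewrite mul_scalar_mx -scalemxAl !mxE; ring.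
Qed.

Lemma seq_argmax (R : realDomainType) (T : eqType) (f : T -> R) (s : seq T) x0 :
  x0 \in s -> exists2 x, x \in s & forall y, y \in s -> f y <= f x.
Proof.
elim: s x0 => // x s IH x0 _.
case: s IH => [_|y s IH].
  by exists x => [|z]; rewrite inE // => /eqP->.
have [z zs hz] := IH y (mem_head _ _).
have [xz|zx] := leP (f x) (f z).
  exists z => [|t]; first by rewrite inE zs orbT.
  by rewrite inE => /orP[/eqP->|/hz].
exists x => [|t]; first by rewrite mem_head.
by rewrite inE => /orP[/eqP->|/hz /le_trans] //; apply; apply: ltW.
Qed.

Section SpectralRadiusTheory.
Context (R : realType).

Lemma normc_norm (z : R[i]) : `|z| = (ComplexField.Normc.normc z)%:C%C.
Proof. by []. Qed.

Lemma normc_ge0 (z : R[i]) : 0 <= ComplexField.Normc.normc z.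
Proof. by rewrite -lecR -normc_norm normr_ge0. Qed.

(** Over the complex numbers the characteristic polynomial splits into a finite list of roots,
    nonempty as its degree is [n.+1], so the supremum is attained. *)
Lemma sp_bounds n (A : 'M[R]_n.+1) :
  [/\ (forall z, eigenvalue (map_mx (real_complex R) A) z ->
        ComplexField.Normc.normc z <= sp A) &
      exists2 z, eigenvalue (map_mx (real_complex R) A) z &
        ComplexField.Normc.normc z = sp A].
Proof.
set B := map_mx _ A.
have [rs hrs] := closed_field_poly_normal (char_poly B).
rewrite (eqP (char_poly_monic B)) scale1r in hrs.
have ev z : eigenvalue B z = (z \in rs).
  by rewrite eigenvalue_root_char hrs root_prod_XsubC.
have [z0 z0rs] : exists z0, z0 \in rs.
  case: rs hrs {ev} => [|z rs] hrs; last by exists z; rewrite mem_head.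
  by have := size_char_poly B; rewrite hrs big_nil size_poly1.
have [z1 z1rs hmax] := seq_argmax (@ComplexField.Normc.normc R) z0rs.
suff sp1 : sp A = ComplexField.Normc.normc z1.
  split; last by exists z1; rewrite ?ev.
  by move=> z; rewrite ev sp1 => /hmax.
rewrite /sp; set E := image _ _.
have ubE : ubound E (ComplexField.Normc.normc z1).
  by move=> _ [z /= hz <-]; apply: hmax; rewrite -ev.
have E1 : E (ComplexField.Normc.normc z1) by exists z1 => //=; rewrite -/B ev.
apply/eqP; rewrite eq_le; apply/andP; split; first by apply: ge_sup => //;
  exists (ComplexField.Normc.normc z1).
by apply: ub_le_sup E1; exists (ComplexField.Normc.normc z1).
Qed.

Lemma sp_dim0 (A : 'M[R]_0) : sp A = 0.
Proof.
rewrite /sp -[RHS](sup0 R); congr (sup _).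
rewrite -subset0 => x [z /eigenvalueP[v _ v0] _].
by case/eqP: v0; apply/rowP => -[].
Qed.

Lemma sp_ge0 n (A : 'M[R]_n) : 0 <= sp A.
Proof.
case: n A => [|n] A; first by rewrite sp_dim0.
by have [_ [z _ <-]] := sp_bounds A; apply: normc_ge0.
Qed.

Lemma sp_power_bound n (A : 'M[R]_n) r : sp A < r ->
  exists2 K, 0 <= K & forall m i j, `|(A ^+ m) i j| <= K * r ^+ m.
Proof.
case: n A => [|n] A hr; first by exists 0 => // m [].
have r0 : 0 < r by rewrite (le_lt_trans _ hr) // sp_ge0.
have [hsp _] := sp_bounds A.
have h i j : exists K, forall m, `|(A ^+ m) i j| <= K * r ^+ m.
  have [|K hK] := @power_bound_closed R[i] n (map_mx (real_complex R) A) r%:C%C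
    _ i j.
    by move=> z /hsp hz; rewrite normc_norm ltcR (le_lt_trans hz).
  exists (ComplexField.Normc.normc K) => m.
  have := hK m; rewrite -rmorphXn mxE normc_norm.
  have -> : ComplexField.Normc.normc (real_complex R ((A ^+ m) i j)) = `|(A ^+
    m) i j|.
    by rewrite /= expr0n addr0 sqrtr_sqr.
  move=> h; rewrite -lecR.
  have -> : (ComplexField.Normc.normc K * r ^+ m)%:C%C = `|K| * r%:C%C ^+ m.
    by rewrite normc_norm -rmorphXn -rmorphM.
  have K0 : 0 <= K by have := hK 0; rewrite expr0 mulr1; apply: le_trans.
  by rewrite (ger0_norm K0).
have [||K K0 hK] := @uniform_bound R _ (enum {: 'I_n.+1 * 'I_n.+1})
    (fun p K => forall m, `|(A ^+ m) p.1 p.2| <= K * r ^+ m).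
- by move=> x b b' bb' H m; apply: le_trans (H m) _;
    rewrite ler_wpM2r // exprn_ge0 // ltW.
- by move=> p _; apply: h.
exists K => // m i j; by apply: (hK (i, j)); rewrite mem_enum.
Qed.

(** An eigenvector [v] for an eigenvalue of modulus [sp A] is scaled exactly by the powers of [A],
    and [c] compares one nonzero entry of [v] with the sum of all. Exponents are positive because in
    dimension 0 [sp A ^+ 0] is 1. *)
Lemma sp_lower_bound n (A : 'M[R]_n) : exists2 c, 0 < c &
  forall m u, 0 <= u -> (forall i j, `|(A ^+ m.+1) i j| <= u) ->
    c * sp A ^+ m.+1 <= u.
Proof.
case: n A => [|n] A; first by exists 1 => // m u u0 _;
  rewrite sp_dim0 expr0n mulr0.
have [_ [z /eigenvalueP[v hv v0] <-]] := sp_bounds A.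
set B := map_mx _ _ in hv.
have hvm m : v *m B ^+ m = z ^+ m *: v.
  elim: m => [|m IH]; first by rewrite !expr0 mulmx1 scale1r.
  by rewrite exprSr -mulmxE mulmxA IH -scalemxAl hv scalerA -exprSr.
have [j vj] : exists j, v ord0 j != 0.
  apply/existsP; apply: contraNT v0; rewrite negb_exists => /forallP h.
  by apply/eqP/rowP => j; rewrite mxE; apply/eqP; have := h j; rewrite negbK.
pose N (x : R[i]) := ComplexField.Normc.normc x.
pose a := \sum_i N (v ord0 i).
have N_gt0 : 0 < N (v ord0 j).
  by rewrite -ltcR -normc_norm normr_gt0.
have a0 : 0 < a.
  by rewrite /a (bigD1 j) //= ltr_wpDr // sumr_ge0 // => i _; apply: normc_ge0.
exists (N (v ord0 j) / a) => [|m u u0 hu]; first by rewrite divr_gt0.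
rewrite mulrAC ler_pdivrMr // -lecR mulrC.
have -> : (N z ^+ m.+1 * N (v ord0 j))%:C%C = `|(z ^+ m.+1 *: v) ord0 j|.
  by rewrite mxE normrM normrX !normc_norm -rmorphXn -rmorphM.
rewrite -hvm mxE (le_trans (ler_norm_sum _ _ _)) //.
rewrite /a mulr_sumr raddf_sum; apply: ler_sum => i _.
rewrite normrM [leRHS](_ : _ = `|v ord0 i| * u%:C%C);
  last by rewrite /= mulrC rmorphM normc_norm.
rewrite ler_wpM2l //.
rewrite -rmorphXn mxE normc_norm lecR.
by rewrite /= expr0n addr0 sqrtr_sqr.
Qed.

End SpectralRadiusTheory.

Lemma intr_mxX (R : realType) k (D : 'M[int]_k) m i j :
  (map_mx (fun z : int => z%:~R : R) D ^+ m) i j = ((D ^+ m) i j)%:~R.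
Proof.
have -> : map_mx (fun z : int => z%:~R : R) D ^+ m = map_mx (intmul 1) (D ^+ m).
  by rewrite (rmorphXn (map_mx (intmul (1 : R)))).
by rewrite mxE.
Qed.

(** The entries of [D ^+ m] are integers tending to 0, hence eventually 0. *)
Lemma int_matrix_nilpotent (R : realType) k (D : 'M[int]_k) :
  sp (map_mx (fun z : int => z%:~R : R) D) < 1 -> exists m, D ^+ m = 0.
Proof.
set A := map_mx _ D => hA.
have [r /andP[Ar r1]] : exists r, sp A < r < 1.
  by exists ((sp A + 1) / 2); rewrite midf_lt // midf_lt.
have r0 : 0 <= r by rewrite (le_trans (sp_ge0 A)) // ltW.
have [K K0 hK] := sp_power_bound Ar.
have [|m _ hm] := @exists_exp_lt R r (2 * (K + 1))^-1 r0 r1.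
  by rewrite invr_gt0 mulr_gt0 // ltr_wpDl.
exists m; apply/matrixP => i j; rewrite mxE.
have := hK m i j; rewrite intr_mxX -intr_norm => h.
apply/eqP; rewrite -normr_le0 -ltzD1 add0r -(ltr_int R) (le_lt_trans h) //.
apply: le_lt_trans (ler_wpM2l K0 hm) _.
by rewrite -[_ / _]/(K / _) ltr_pdivrMr; lra.
Qed.

(** * Growth rates *)

Lemma exp_near_le (R : realType) (a e : R) : 0 <= a -> a < 1 -> 0 < e ->
  \forall m \near \oo, a ^+ m <= e.
Proof.
move=> a0 a1 e0; have [p _ hp] := exists_exp_lt a0 a1 e0.
exists p => // m /= pm; apply: le_trans hp.
by rewrite ler_wiXn2l // ltW.
Qed.

(** Constants do not affect [m]-th roots in the limit: a slightly larger or smaller base absorbs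
    them once [m] is large. *)
Lemma root_limit (R : realType) (u : nat -> R) (l : R) : 0 <= l ->
  (forall m, 0 <= u m) ->
  (exists2 c, 0 < c & forall m, c * l ^+ m.+1 <= u m.+1) ->
  (forall r, l < r -> exists C, \forall m \near \oo, u m <= C * r ^+ m) ->
  lim ((fun m => u m `^ (m%:R^-1)) @ \oo) = l.
Proof.
move=> l0 u0 [c c0 hc] hr; apply/cvg_lim => //; apply/cvgrPdist_le => e e0.
have rootX m (x : R) : (0 < m)%N -> 0 <= x -> (x ^+ m) `^ (m%:R^-1) = x.
  by move=> m0 x0; rewrite -powR_mulrn // -powRrM divff ?powRr1 //
    pnatr_eq0 -lt0n.
have mono m (x y : R) : 0 <= x -> 0 <= y -> x <= y ->
  x `^ (m%:R^-1) <= y `^ (m%:R^-1).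
  by move=> x0 y0 xy; apply: ge0_ler_powR; rewrite ?nnegrE.
have up : \forall m \near \oo, u m `^ (m%:R^-1) <= l + e.
  have [|C hC] := hr (l + e / 2); first by rewrite ltrDl divr_gt0.
  have hB : \forall m \near \oo, ((l + e / 2) / (l + e)) ^+ m <= (`|C| + 1)^-1.
    apply: exp_near_le.
    - by apply: divr_ge0; lra.
    - by rewrite ltr_pdivrMr; lra.
    - by rewrite invr_gt0 ltr_wpDl.
  near=> m.
  have m0 : (0 < m)%N by near: m; exists 1%N.
  have le0 : 0 < l + e by lra.
  rewrite -[leRHS](rootX m _ m0 (ltW le0)); apply: mono => //;
    first by rewrite exprn_ge0 // ltW.
  have h1 : u m <= C * (l + e / 2) ^+ m by near: m.
  have h2 : ((l + e / 2) / (l + e)) ^+ m <= (`|C| + 1)^-1 by near: m.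
  apply: le_trans h1 _.
  move: h2; rewrite expr_div_n ler_pdivrMr ?exprn_gt0 // => h2.
  have p1 : 0 <= (l + e / 2) ^+ m by rewrite exprn_ge0 //; lra.
  have C1 : 0 < `|C| + 1 by rewrite ltr_wpDl.
  apply: (@le_trans _ _ ((`|C| + 1) * (l + e / 2) ^+ m)).
    by rewrite ler_wpM2r // (le_trans (ler_norm _)) // lerDl.
  by rewrite -ler_pdivlMl.
have low : \forall m \near \oo, l - e <= u m `^ (m%:R^-1).
  (* For [l <= e] the lower bound is trivial, as roots are nonnegative; otherwise [l] is positive
     and can be divided by. *)
  have [el|le] := leP (l - e) 0; first by near=> m;
    apply: le_trans el (powR_ge0 _ _).
  have hB : \forall m \near \oo, ((l - e) / l) ^+ m <= c.
    apply: exp_near_le => //.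
    - by apply: divr_ge0; lra.
    - by rewrite ltr_pdivrMr; lra.
  near=> m.
  have m0 : (0 < m)%N by near: m; exists 1%N.
  rewrite -[leLHS](rootX m _ m0 (ltW le)); apply: mono => //;
    first by rewrite exprn_ge0 // ltW.
  have h2 : ((l - e) / l) ^+ m <= c by near: m.
  have := hc m.-1; rewrite prednK // => /(le_trans _); apply.
  by rewrite -ler_pdivrMr -?expr_div_n // exprn_gt0; lra.
near=> m; rewrite ler_distl; apply/andP; split.
  by rewrite lerBlDr; near: m; exact: up.
by rewrite -lerBlDr; near: m; exact: low.
Unshelve. all: by end_near. Qed.

Section GrowthRate.
Context (R : realType) (pi : groupType) (S : seq pi) (phi :
  {multiplicative pi -> pi}).
Context (k : nat) (s : 'I_k -> pi) (D1 : 'M[int]_k).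
Hypotheses (genS : generates S) (tf : torsion_free pi) (nil :
  nilpotent_group pi).
Hypotheses (basis : isolator_basis 1 s) (D1P : induced_matrix phi 1 s D1).

Local Notation D1R := (map_mx (fun z : int => z%:~R : R) D1).

(** If [sp D1R < 1], a power of [phi] maps into the isolator of the second term and the iterates
    become trivial; the bound then holds with [C = 0], but only eventually. Otherwise an
    intermediate rate [r1] feeds [growth_word_length], which asks the abelianization to grow
    strictly slower than [r]. *)
Lemma length_eventual (r : R) : sp D1R < r ->
  forall x, exists C, \forall m \near \oo, (word_length S (iter m phi x))%:R <=
    C * r ^+ m.
Proof.
move=> hr x; have [lam1|lam1] := leP 1 (sp D1R); last first.
  have [m hm] := int_matrix_nilpotent lam1.
  have [y|p hp] := @iter_trivial pi (iter_hom phi m) tf nil.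
    by apply: (@abcoord_isolator _ _ _ basis);
      rewrite (abcoord_iter _ D1P) hm mul0mx.
  have {}hp y : iter (p * m) phi y = 1%g by rewrite -[RHS](hp y) iterM.
  exists 0; exists (p * m)%N => // q /= pq.
  by rewrite -(subnK pq) addnC iterD hp word_length1 // mul0r.
pose r1 := (sp D1R + r) / 2.
have r1l : sp D1R < r1 by rewrite /r1; lra.
have [K K0 hK] := sp_power_bound r1l.
have r1_ge1 : 1 <= r1 by rewrite /r1; lra.
have [|||y|C hC] := @growth_word_length R pi S phi genS r1 r _ _ _ _ nil x.
- by rewrite /r1; lra.
- by rewrite /r1; lra.
- by lra.
- apply: (growth_abelian basis D1P genS (C := K)) => // m i j.
  by rewrite -intr_mxX.
- by exists C; near=> m.
Unshelve. all: by end_near. Qed.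

(** Stated for an arbitrary [f] so that it serves both [phi] and [ab_map phi], each compared with
    the same matrix [D1]. *)
Lemma growth_rate_sp (H : groupType) (T : seq H) (f : {multiplicative H -> H}) :
  (exists2 C : R, 0 <= C & forall m i j,
    `|((D1 ^+ m) i j)%:~R| <= C * (max_length f T m)%:R) ->
  (forall r : R, sp D1R < r -> forall x, x \in T -> exists C,
    \forall m \near \oo, (word_length T (iter m f x))%:R <= C * r ^+ m) ->
  GR R f T = sp D1R.
Proof.
move=> [C C0 hC] up; apply: root_limit => //; first exact: sp_ge0.
  have [c c0 hc] := sp_lower_bound D1R.
  exists (c / (C + 1)) => [|m]; first by rewrite divr_gt0 // ltr_wpDl.
  rewrite mulrAC ler_pdivrMr ?ltr_wpDl //.
  apply: hc => [|i j]; first by rewrite mulr_ge0 // addr_ge0.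
  rewrite intr_mxX (le_trans (hC _ _ _)) // mulrC ler_wpM2l //.
  by rewrite lerDl.
move=> r lr; have r0 : 0 <= r by rewrite (le_trans (sp_ge0 D1R)) // ltW.
have [|x xT|B B0 hB] := @uniform_bound R _ T (fun x C => \forall m \near \oo,
   (word_length T (iter m f x))%:R <= C * r ^+ m).
- move=> x b b' bb'; apply: filterS => m /le_trans; apply.
  by rewrite ler_wpM2r // exprn_ge0.
- exact: up.
exists B.
suff : \forall m \near \oo, forall x, x \in T ->
  (word_length T (iter m f x))%:R <= B * r ^+ m.
  apply: filterS => m h; rewrite /max_length big_seq.
  elim/big_ind : _ => [|x y hx hy|x xS]; last exact: h.
    by rewrite mulr_ge0 // exprn_ge0.
  by rewrite /maxn; case: ifP.
suff /(_ T) : forall t : seq H, {subset t <= T} -> \forall m \near \oo,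
    forall x, x \in t -> (word_length T (iter m f x))%:R <= B * r ^+ m by apply.
elim=> [_|x t IH sub]; first by near=> m.
have hx := hB x (sub x (mem_head _ _)).
have {}IH : \forall m \near \oo, forall y, y \in t ->
  (word_length T (iter m f y))%:R <= B * r ^+ m.
  by apply: IH => y yt; apply: sub; rewrite inE yt orbT.
by near=> m => y; rewrite inE => /orP[/eqP->|]; [near: m|move: y; near: m].
Unshelve. all: by end_near. Qed.

Lemma growth_rate_group : GR R phi S = sp D1R.
Proof.
apply: growth_rate_sp; first exact: (matrix_le_max_length R basis D1P).
by move=> r hr x _; apply: length_eventual.
Qed.

(** The projection to the abelianization is Lipschitz, so the upper bound descends from [pi]; the
    lower bound again comes from the coordinates. *)
Lemma growth_rate_ab (Sab : seq (abelianization pi)) : generates Sab ->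
  GR R (ab_map phi) Sab = sp D1R.
Proof.
move=> genSab; apply: growth_rate_sp;
  first exact: (matrix_le_max_length_ab R basis D1P).
move=> r hr x _; rewrite -[x]ab_reprP.
have [K K0 hK] := ab_proj_lipschitz R genS genSab.
have [C hC] := length_eventual hr (repr x); exists (K * C).
apply: filterS hC => m hm; rewrite iter_ab_map (le_trans (hK _)) // -mulrA.
by rewrite ler_wpM2l.
Qed.

(** If [r < sp D1R], then [c * sp D1R ^+ m] is at most [(|C| + 1) * r ^+ m] for positive [m], while
    a suitable [m] makes the latter at most half of the former. *)
Lemma sp_le_of_power_bound (r C : R) : 0 <= r ->
  (forall m i j, `|((D1 ^+ m) i j)%:~R| <= C * r ^+ m) -> sp D1R <= r.
Proof.
move=> r0 hC; rewrite leNgt; apply/negP => rl.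
have l0 : 0 < sp D1R by rewrite (le_lt_trans r0).
have [c c0 hc] := sp_lower_bound D1R.
have [|||m m0 hm] := @exists_exp_lt R (r / sp D1R) (c / (2 * (`|C| + 1))).
- by rewrite divr_ge0 // ltW.
- by rewrite ltr_pdivrMr // mul1r.
- by rewrite divr_gt0 // mulr_gt0 // ltr_wpDl.
have C1 : 0 < `|C| + 1 by rewrite ltr_wpDl.
have rm : 0 <= r ^+ m by rewrite exprn_ge0.
have lm : 0 < sp D1R ^+ m by rewrite exprn_gt0.
have : c * sp D1R ^+ m <= (`|C| + 1) * r ^+ m.
  rewrite -(prednK m0); apply: hc => [|i j]; rewrite prednK //;
    first by rewrite mulr_ge0 // ltW.
  rewrite intr_mxX (le_trans (hC _ _ _)) // ler_wpM2r //.
  by rewrite (le_trans (ler_norm _)) // lerDl.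
move: hm; rewrite expr_div_n ler_pdivrMr // => hm.
move=> /le_trans /(_ (ler_wpM2l (ltW C1) hm)).
have -> : (`|C| + 1) * (c / (2 * (`|C| + 1)) * sp D1R ^+ m) = c * sp D1R ^+ m /
  2.
  by field; rewrite gt_eqF.
by have := mulr_gt0 c0 lm; lra.
Qed.

End GrowthRate.

(** * Differentiable maps *)

Section RowNorm.
Context (R : realType) (n : nat).
Implicit Types (u v : 'rV[R]_n) (A : 'M[R]_n).

Lemma row_norm_entry v j : `|v ord0 j| <= `|v|.
Proof.
rewrite [leRHS]/Num.Def.normr/= mx_normrE.
exact: (le_bigmax _ (fun ij => `|v ij.1 ij.2|) (ord0, j)).
Qed.

Lemma row_norm_le v b : 0 <= b -> (forall j, `|v ord0 j| <= b) -> `|v| <= b.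
Proof.
move=> b0 h; rewrite [leLHS]/Num.Def.normr/= mx_normrE.
by apply: bigmax_le => // -[i j] _; rewrite ord1.
Qed.

Lemma row_norm_mulmx A v a : 0 <= a -> (forall i j, `|A i j| <= a) ->
  `|v *m A| <= n%:R * a * `|v|.
Proof.
move=> a0 hA; apply: row_norm_le => [|j]; first by rewrite !mulr_ge0.
rewrite mxE (le_trans (ler_norm_sum _ _ _)) //.
apply: (@le_trans _ _ (\sum_(i < n) a * `|v|)).
  by apply: ler_sum => i _; rewrite normrM mulrC ler_pM // row_norm_entry.
by rewrite sumr_const card_ord -[leLHS]mulr_natl mulrA.
Qed.

Definition adapted_norm A (r : R) (Nm : 'rV[R]_n -> R) K :=
  [/\ 0 < K, forall v, `|v| <= Nm v, forall v, Nm v <= K * `|v|,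
      forall u v, Nm (u + v) <= Nm u + Nm v &
        forall v, Nm (v *m A) <= r * Nm v].

Lemma adapted_norm_exists A r : sp A < r ->
  exists Nm K, adapted_norm A r Nm K.
Proof.
move=> hr; pose r1 := (sp A + r) / 2.
have s0 := sp_ge0 A.
have r1l : sp A < r1 by rewrite /r1; lra.
have r1r : r1 < r by rewrite /r1; lra.
have r10 : 0 < r1 by rewrite (le_lt_trans _ r1l).
have r0 : 0 < r by rewrite (lt_trans r10).
have [C C0 hC] := sp_power_bound r1l.
have nC : 0 < n%:R * C + 1 by rewrite ltr_wpDl // mulr_ge0.
have [|||p p0 hp] := @exists_exp_lt R (r1 / r) (n%:R * C + 1)^-1.
- by rewrite divr_ge0 // ltW.
- by rewrite ltr_pdivrMr // mul1r.
- by rewrite invr_gt0.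
have {}hp : n%:R * (C * r1 ^+ p) <= r ^+ p.
  move: hp; rewrite expr_div_n ler_pdivrMr ?exprn_gt0 // ler_pdivlMl // => hp.
  apply: le_trans hp; rewrite mulrA ler_wpM2r ?exprn_ge0 1?ltW //.
  by rewrite ltrDl.
case: p p0 hp => // p _ hp.
(* The norm is a weighted sum of sup norms along the orbit. Multiplication by [A] shifts the sum;
   the new last term is at most [r * |v|] by the choice of [p] and replaces the lost first one. *)
exists (fun v => \sum_(k < p.+1) r ^- k * `|v *m A ^+ k|).
exists (1 + \sum_(k < p.+1) r ^- k * (n%:R * (C * r1 ^+ k))).
have rk k : 0 <= r ^- k by rewrite invr_ge0 exprn_ge0 // ltW.
have r1k k : 0 <= C * r1 ^+ k by rewrite mulr_ge0 // exprn_ge0 // ltW.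
split.
- by rewrite ltr_pwDl // sumr_ge0 // => k _; rewrite mulr_ge0 // mulr_ge0.
- move=> v; rewrite big_ord_recl expr0 invr1 mul1r mulmx1 lerDl.
  by rewrite sumr_ge0 // => k _; rewrite mulr_ge0.
- move=> v; rewrite mulrDl mul1r ler_wpDl // mulr_suml; apply: ler_sum => k _.
  by rewrite -mulrA ler_wpM2l // row_norm_mulmx.
- move=> u v; rewrite -big_split; apply: ler_sum => k _.
  by rewrite /= -mulrDr ler_wpM2l // mulmxDl ler_normD.
- move=> v; rewrite big_ord_recr [in leRHS]big_ord_recl /= mulrDr.
  rewrite addrC; apply: lerD.
    rewrite expr0 invr1 mul1r mulmx1 -mulmxA mulmxE -exprS.
    have -> : r * `|v| = r ^- p * (r ^+ p.+1 * `|v|).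
      by rewrite mulrA; congr (_ * _);
        rewrite exprSr mulrA mulVf ?mul1r // expf_neq0 // gt_eqF.
    rewrite ler_wpM2l // (le_trans (row_norm_mulmx v (r1k _) (hC _))) //.
    by rewrite ler_wpM2r.
  rewrite mulr_sumr; apply: ler_sum => k _.
  rewrite /bump leq0n add1n -mulmxA mulmxE -exprS mulrA ler_wpM2r //.
  by rewrite exprS invfM mulVKf // gt_eqF.
Qed.

Lemma local_contraction (f : 'rV[R]_n -> 'rV[R]_n) o r :
  differentiable f o -> f o = o -> sp (jacobian f o) < r ->
  exists Nm K, adapted_norm (jacobian f o) r Nm K /\
    \forall v \near o, Nm (f v - o) <= r * Nm (v - o).
Proof.
move=> df fo hr; pose r1 := (sp (jacobian f o) + r) / 2.
have r1l : sp (jacobian f o) < r1 by rewrite /r1; lra.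
have r1r : r1 < r by rewrite /r1; lra.
have [Nm [K [K0 h1 hK hD hJ]]] := adapted_norm_exists r1l.
have Nm0 v : 0 <= Nm v by rewrite (le_trans _ (h1 v)).
exists Nm, K; split.
  by split=> // v; apply: le_trans (hJ v) _; rewrite ler_wpM2r // ltW.
have /eqaddoP := diff_locally df.
(* The tolerance is such that the remainder, at most [K] times larger in the adapted norm, fits into
   the gap [r - r1]. *)
move=> /(_ ((r - r1) / K)); rewrite divr_gt0 ?subr_gt0 // => /(_ isT) H0.
have := H0 : \forall h \near (0 : 'rV[R]_n),
  `|f (h + o) - (f o + 'd f o h)| <= (r - r1) / K * `|h|.
rewrite (near_shift o 0) => H; apply: filterS H => v /=.
rewrite sub0r -[v + - o]/(v - o) subrK fo; set h := v - o => hv.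
have -> : f v - o = (f v - (o + 'd f o h)) + h *m jacobian f o.
  by rewrite /jacobian mul_rV_lin1 opprD !addrA subrK.
apply: le_trans (hD _ _) _; apply: le_trans (lerD (hK _) (hJ _)) _.
have := ler_wpM2l (ltW K0) hv; rewrite [leRHS]mulrA mulrCA divff ?gt_eqF //
  mulr1 => hv'.
apply: le_trans (lerD hv' (lexx _)) _.
have r10 : 0 <= r - r1 by lra.
by have := ler_wpM2l r10 (h1 h); rewrite -/h; lra.
Qed.

End RowNorm.

Section MeanValue.
Context (R : realType) (V : normedModType R) (n : nat).

Lemma is_derive_line (f : V -> 'rV[R]_n) x v t j :
  differentiable f (x + t *: v) ->
  is_derive t (1 : R) (fun t : R =>
    f (x + t *: v) ord0 j) ('d f (x + t *: v) v ord0 j).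
Proof.
move=> df; have dv : derivable f (x + t *: v) v by apply: diff_derivable.
have hc : (fun h => h^-1 *: ((f \o shift (x + t *: v)) (h *: v) - f (x + t *:
  v))) @ 0^'
   --> 'd f (x + t *: v) v.
  by rewrite -deriveE //; apply: dv.
have : (fun h : R => h^-1 *: (((fun t : R =>
  f (x + t *: v) ord0 j) \o shift t) (h *: 1)
    - f (x + t *: v) ord0 j)) @ 0^' --> 'd f (x + t *: v) v ord0 j.
  have := cvg_comp _ _ hc (@coord_continuous R 1 n ord0 j _).
  apply: cvg_trans; apply: near_eq_cvg; near=> h => /=.
  by rewrite !mxE /= [h *: 1]mulr1 scalerDl addrCA.
by move=> h; apply: DeriveDef; [apply/cvg_ex; eexists;
  exact: h | apply/cvg_lim].
Unshelve. all: by end_near. Qed.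

(** Rows carry the sup norm, so the one-variable mean value theorem is applied to each coordinate
    along the segment. *)
Lemma mean_value_le (f : V -> 'rV[R]_n) x v (C : R) :
  (forall t : R, 0 <= t <= 1 -> differentiable f (x + t *: v) /\
     `|'d f (x + t *: v) v| <= C) ->
  `|f (x + v) - f x| <= C.
Proof.
move=> h; have C0 : 0 <= C.
  have /h[_ h0] : 0 <= (0 : R) <= 1 by rewrite lexx ler01.
  exact: le_trans h0.
apply: row_norm_le => // j.
have [||t t01 ht] := @MVT_segment R (fun t : R => f (x + t *: v) ord0 j)
   (fun t => 'd f (x + t *: v) v ord0 j) 0 1 ler01.
- move=> t; rewrite in_itv /= => /andP[t0 t1]; apply: is_derive_line.
  by have /h[] : 0 <= t <= 1 by rewrite !ltW.
- move=> t; apply: continuous_in_subspaceT => {}t.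
  rewrite inE /= in_itv /= => t01; apply: differentiable_continuous.
  by apply/derivable1_diffP; have [df _] := h t t01;
    have [] := @is_derive_line f x v t j df.
move: t01; rewrite in_itv /= => /h[_ le_t].
move: ht; rewrite scale1r scale0r addr0 subr0 mulr1 !mxE => ->.
exact: le_trans (row_norm_entry _ _) le_t.
Qed.

End MeanValue.

Lemma C1_lipschitz (R : realType) (V : normedModType R) (m n : nat) (f :
  V * 'rV[R]_m -> 'rV[R]_n) (A : set (V * 'rV[R]_m)) a b :
  open A -> A (a, b) -> Ck_on 1 A f ->
  exists2 C, 0 < C & exists2 e : R, 0 < e & forall x y z,
    `|x - a| < e -> `|y - b| < e -> `|z - b| < e ->
    `|f (x, z) - f (x, y)| <= C * `|z - y|.
Proof.
move=> oA Aab [df dfc].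
(* [Ck_on] gives continuity of directional derivatives in fixed directions only, so the second
   variable is treated through its basis directions [w j], whose derivatives are then bounded near
   [(a, b)]. *)
pose w (j : 'I_m) : V * 'rV[R]_m := (0, delta_mx ord0 j).
pose c j := `|'d f (a, b) (w j)| + 1.
have hc : \forall p \near (a, b), forall j, `|'d f p (w j)| <= c j.
  apply: (@filter_forall _ _ (fun (j : 'I_m) p =>
    `|'d f p (w j)| <= c j) (nbhs (a, b)) _) => j.
  have /cvgrPdist_le /(_ 1 ltr01) := dfc (w j) _ Aab.
  apply: filterS => p hp; rewrite /c -lerBlDl (le_trans _ hp) //.
  by rewrite distrC lerB_dist.
have hA : \forall p \near (a, b), A p by apply: open_nbhs_nbhs; split.
have /nbhs_normP[e /= e0 he] : \forall p \near (a, b), A p /\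
  forall j, `|'d f p (w j)| <= c j.
  by apply: filterI.
have cj j : 0 <= c j by rewrite /c addr_ge0.
exists (1 + \sum_j c j); first by rewrite ltr_pwDl // sumr_ge0.
exists e => // x y z xa yb zb.
have -> : (x, z) = (x, y) + (0, z - y) by congr pair;
  rewrite /= ?addr0 // addrC subrK.
apply: mean_value_le => t /andP[t0 t1].
have : A ((x, y) + t *: (0, z - y)) /\
  forall j, `|'d f ((x, y) + t *: (0, z - y)) (w j)| <= c j.
  apply: he => /=; rewrite /ball_ /= -[X in `|X|]/(a - (x + t *: 0), b - (y + t
    *: (z - y))).
  rewrite scaler0 addr0 prod_normE /= gt_max distrC xa /=.
  have -> : b - (y + t *: (z - y)) = (1 - t) *: (b - y) + t *: (b - z).
    by rewrite !scalerBr !scalerBl !scale1r; apply/rowP => i; rewrite !mxE;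
      ring.
  apply: le_lt_trans (ler_normD _ _) _;
    rewrite !normrZ !ger0_norm ?subr_ge0 // ![`|b - _|]distrC.
  have [->|tn0] := eqVneq t 0; first by rewrite subr0 mul1r mul0r addr0.
  have : t * `|z - b| < t * e by rewrite ltr_pM2l // lt_neqAle eq_sym tn0.
  by have := ler_wpM2l (_ : 0 <= 1 - t) (ltW yb);
    rewrite subr_ge0 t1 => /(_ isT); lra.
move: (_ + _) => p [Ap hp]; split; first exact: df.
have -> : (0, z - y) = \sum_j (z - y) ord0 j *: w j.
  rewrite {1}[z - y]row_sum_delta /w; apply: injective_projections.
    by rewrite /= raddf_sum big1 // => j _; rewrite /= scaler0.
  by rewrite /= raddf_sum.
rewrite linear_sum; apply: le_trans (ler_norm_sum _ _ _) _.
rewrite mulrDl mul1r mulr_suml ler_wpDl //; apply: ler_sum => j _.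
by rewrite linearZ normrZ mulrC ler_pM // row_norm_entry.
Qed.

(** * Lie groups and lattices *)

Section SetPowers.
Context (G : groupType).
Implicit Types (A B : set G) (x y : G).

Fixpoint setpow A m : set G :=
  if m is m'.+1 then [set (x * y)%g | x in setpow A m' & y in A] else [set 1%g].

Lemma setpowD A m m' x y : setpow A m x -> setpow A m' y ->
  setpow A (m + m') (x * y)%g.
Proof.
move=> hx; elim: m' y => [y ->|m' IH _ [y hy [z hz <-]]];
  first by rewrite addn0 mulg1.
by rewrite addnS mulgA; exists (x * y)%g; [exact: IH|exists z].
Qed.

Lemma setpow_mul A B N m : A `<=` setpow B N ->
  setpow A m `<=` setpow B (m * N).
Proof.
move=> AB; elim: m => [|m IH] //= _ [x hx [y hy <-]].
by rewrite mulSn addnC; apply: setpowD; [exact: IH|exact: AB].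
Qed.

Lemma setpow_le A m m' : A 1%g -> (m <= m')%N -> setpow A m `<=` setpow A m'.
Proof.
move=> A1; elim: m' => [|m' IH]; first by rewrite leqn0 => /eqP->.
rewrite leq_eqVlt => /orP[/eqP-> //|/IH h] x /h hx.
by exists x => //; exists 1%g; rewrite ?mulg1.
Qed.

Lemma setpow_hom (f : {multiplicative G -> G}) A B m : (forall x, A x ->
  B (f x)) ->
  forall x, setpow A m x -> setpow B m (f x).
Proof.
move=> AB; elim: m => [|m IH] x; first by move=> ->; apply: hom1.
by move=> [y hy [z hz <-]]; exists (f y); [exact: IH|exists (f z);
  [exact: AB|rewrite gmulfM]].
Qed.

End SetPowers.

Section LieGroup.
Context (R : realType) (n : nat) (G : lieGroupType R n).
Implicit Types (x y g : G).

Lemma lie_cvgM (T : Type) (F : set_system T) (FF : Filter F) (f g : T ->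
  G) a b :
  f @ F --> a -> g @ F --> b -> (fun t => f t * g t)%g @ F --> (a * b)%g.
Proof.
move=> fa gb; have [mul_cont _] := @lie_mul_smooth R n G.
by apply: (cvg_comp2 (h := fun x y => x * y)%g fa gb); apply: (mul_cont (a, b)).
Qed.

Lemma lie_cvgV (T : Type) (F : set_system T) (FF : Filter F) (f : T -> G) a :
  f @ F --> a -> (fun t => (f t)^-1)%g @ F --> (a^-1)%g.
Proof.
move=> fa; have [inv_cont _] := @lie_inv_smooth R n G.
exact: (cvg_comp _ _ fa (inv_cont a)).
Qed.

Lemma near_translate (A : set G) g : nbhs (1%g : G) A ->
  \forall y \near g, A (g^-1 * y)%g.
Proof.
move=> hA; have : (fun y => g^-1 * y)%g @ g --> (g^-1 * g)%g.
  by apply: lie_cvgM; [exact: cvg_cst|exact: cvg_id].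
by rewrite mulVg => /(_ _ hA).
Qed.

(** The set of finite products from [A] is open and closed: for [y] near [g], both [g^-1 * y] and
    [y^-1 * g] lie in [A]. *)
Lemma connected_generated (A : set G) : connected [set: G] -> nbhs (1%g :
  G) A ->
  forall g, exists m, setpow A m g.
Proof.
move=> cG hA; pose H := [set g | exists m, setpow A m g].
suff HT : H = setT by move=> g; have : setT g by []; rewrite -HT.
have nH g : \forall y \near g, H g -> H y.
  have := near_translate g hA; apply: filterS => y hy [m hm]; exists m.+1.
  by exists g => //; exists (g^-1 * y)%g => //; rewrite mulVKg.
have nH' g : \forall y \near g, H y -> H g.
  have : (fun y => y^-1 * g)%g @ g --> (g^-1 * g)%g.
    by apply: lie_cvgM; [apply: lie_cvgV; exact: cvg_id|exact: cvg_cst].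
  rewrite mulVg => /(_ _ hA) h; apply: (@filterS _ (nbhs g) _ _ _ _ h) =>
    y hy [m hm]; exists m.+1.
  by exists y => //; exists (y^-1 * g)%g => //; rewrite mulVKg.
apply: cG.
- by exists 1%g, 0%N.
- exists H; last by rewrite setTI.
  rewrite openE => g Hg; suff : nbhs g H by [].
  by apply: filterS (nH g) => y; apply.
- exists H; last by rewrite setTI.
  rewrite closedE => g; apply: contra_notP => Hg.
  by apply: filterS (nH' g) => y hy /hy.
Qed.

Section Chart.
Context (c : chart R n G).
Hypotheses (cA : @atlas R n G c) (c1 : cdom c (1%g : G)).
Let o := cmap c 1%g.
Let V := cmap c @` cdom c.

Lemma cmap_cvg x : cdom c x -> cmap c @ x --> cmap c x.
Proof.
move=> cx; have := @cmap_continuous _ _ _ c; rewrite continuous_open_subspace;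
  last exact: cdom_open.
by apply; rewrite inE.
Qed.

Lemma cinv_cvg v : V v -> cinv c @ v --> cinv c v.
Proof.
move=> cv; have := @cinv_continuous _ _ _ c; rewrite continuous_open_subspace;
  last exact: cimg_open.
by apply; rewrite inE.
Qed.

Lemma cinv_dom v : V v -> cdom c (cinv c v) /\ cmap c (cinv c v) = v.
Proof. by move=> [x cx <-]; rewrite cmapK. Qed.

(** Closed balls, so that small ones are compact; they form a basis of neighbourhoods of the
    identity. *)
Definition chart_ball (e : R) : set G := [set x | cdom c x /\
  `|cmap c x - o| <= e].

Lemma Vo : V o. Proof. by exists 1%g. Qed.

Lemma ball_in_chart : exists2 e : R, 0 < e & forall v, `|v - o| < e -> V v.
Proof.
have : \forall v \near o, V v by apply: open_nbhs_nbhs; split;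
  [exact: cimg_open|exact: Vo].
move=> /nbhs_normP[e /= e0 he]; exists e => // v hv; apply: he.
by rewrite /ball_ /= distrC.
Qed.

Lemma near_chart_ball e : 0 < e -> \forall x \near (1%g : G), chart_ball e x.
Proof.
move=> e0; have h1 : \forall x \near (1%g : G), cdom c x.
  by apply: open_nbhs_nbhs; split=> //; exact: cdom_open.
have /cvgrPdist_le /(_ e e0) h2 := cmap_cvg c1.
by apply: filterS2 h1 h2 => x; rewrite /chart_ball /= distrC.
Qed.

Lemma chart_ball_near (P : set G) : (\forall x \near (1%g : G), P x) ->
  exists2 e : R, 0 < e & forall x, chart_ball e x -> P x.
Proof.
move=> hP; have := cinv_cvg Vo;
  rewrite /o cmapK // => /(_ _ hP) /nbhs_normP[e /= e0 he].
exists (e / 2) => [|x [cx hx]]; first by rewrite divr_gt0.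
rewrite -(cmapK cx); apply: he; rewrite /ball_ /= distrC (le_lt_trans hx) //;
  lra.
Qed.

Lemma chart_ballS e e' : e <= e' -> chart_ball e `<=` chart_ball e'.
Proof. by move=> ee x [cx hx]; split=> //; apply: le_trans ee. Qed.

Lemma chart_ball_compact : exists2 e : R, 0 < e & forall e', e' <= e ->
  compact (chart_ball e').
Proof.
have [e e0 he] := ball_in_chart; exists (e / 2) => [|e' ee];
  first by rewrite divr_gt0.
have sV v : `|v - o| <= e' -> V v by move=> hv; apply: he;
  rewrite (le_lt_trans hv) //; lra.
have -> : chart_ball e' = cinv c @` [set v | `|o - v| <= e'].
  apply/seteqP; split=> [x [cx hx]|_ [v /= hv <-]].
    by exists (cmap c x); rewrite /= ?cmapK // distrC.
  rewrite distrC in hv; have [cv hc] := cinv_dom (sV v hv).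
  by split=> //; rewrite hc.
apply: continuous_compact.
  apply: continuous_in_subspaceT => v; rewrite inE /= distrC => /sV;
    exact: cinv_cvg.
apply: bounded_closed_compact; last exact: closed_closed_ball_.
exists (`|o| + e'); split; first exact: num_real.
move=> b hb v /= hv; rewrite (le_trans _ (ltW hb)) // -[v](subrK o) addrC.
by rewrite (le_trans (ler_normD _ _)) // lerD2l distrC.
Qed.

(** The chart expression of the product [u * v] is Lipschitz in [v] near the identity; it is
    compared at [v = x] and [v = y] for [u = x^-1], where the first value is the identity. *)
Lemma local_lipschitz : exists2 C, 0 < C & exists2 e, 0 < e & forall x y,
  chart_ball e x -> chart_ball e y ->
  cdom c (x^-1 * y)%g /\ `|cmap c (x^-1 * y)%g - o| <= C * `|cmap c y - cmap c
    x|.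
Proof.
have [_ /(_ c c c cA cA cA)] := @lie_mul_smooth R n G.
set A := (X in smooth_on X); set f := (X in smooth_on _ X) => -[oA /(_ 1%N) hf].
have Aoo : A (o, o) by exists (1%g, 1%g) => //=; split=> //; rewrite mulg1.
have [C C0 [e0 e00 hC]] := C1_lipschitz oA Aoo hf.
have e02 : 0 < e0 / 2 by rewrite divr_gt0.
have [e1 e10 h1] : exists2 e : R, 0 < e & forall x, chart_ball e x ->
  chart_ball (e0 / 2) (x^-1)%g.
  apply: chart_ball_near; have /= := near_chart_ball e02.
  have : (fun x : G => x^-1)%g @ (1%g : G) --> (1%g : G).
    by rewrite -[X in _ --> X]invg1; apply: lie_cvgV; exact: cvg_id.
  by move=> h /h.
have [e2 e20 h2] : exists2 e : R, 0 < e & forall x y, chart_ball e x ->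
  chart_ball e y -> cdom c (x^-1 * y)%g.
  have : \forall p \near ((1%g : G), (1%g : G)), cdom c (p.1^-1 * p.2)%g.
    have : (fun p : G * G => p.1^-1 * p.2)%g @ ((1%g : G), (1%g :
      G)) --> (1^-1 * 1 : G)%g.
      by apply: lie_cvgM; [apply: lie_cvgV; exact: cvg_fst|exact: cvg_snd].
    rewrite mulg1 invg1; apply; apply: open_nbhs_nbhs; split=> //;
      exact: cdom_open.
  move=> [[/= A1 A2] [hA1 hA2] hA].
  have [e3 e30 h3] := chart_ball_near hA1;
    have [e4 e40 h4] := chart_ball_near hA2.
  exists (Num.min e3 e4) => [|x y hx hy]; first by rewrite lt_min e30.
  apply: (hA (x, y)); split; [apply: h3|apply: h4].
    by apply: chart_ballS hx; rewrite ge_min lexx.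
  by apply: chart_ballS hy; rewrite ge_min lexx orbT.
exists C => //; exists (Num.min (e0 / 2) (Num.min e1 e2)).
  by rewrite !lt_min e02 e10.
move=> x y hx hy.
have sx e : Num.min (e0 / 2) (Num.min e1 e2) <= e ->
  chart_ball e x by move/chart_ballS; apply.
have sy e : Num.min (e0 / 2) (Num.min e1 e2) <= e ->
  chart_ball e y by move/chart_ballS; apply.
have d := h2 x y (sx _ _) (sy _ _); split; first by apply: d;
  rewrite !ge_min lexx !orbT.
have [cx' hx'] : chart_ball (e0 / 2) (x^-1)%g by apply: h1; apply: sx;
  rewrite !ge_min lexx !orbT.
have [cx lx] : chart_ball (e0 / 2) x by apply: sx; rewrite ge_min lexx.
have [cy ly] : chart_ball (e0 / 2) y by apply: sy; rewrite ge_min lexx.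
have := hC (cmap c (x^-1)%g) (cmap c x) (cmap c y).
rewrite /f /= !cmapK // mulVg -/o; apply;
  apply: le_lt_trans (_ : e0 / 2 < e0) => //; lra.
Qed.

(** The segment from [o] to [cmap c x] is cut into [N.+1] equal pieces; by [local_lipschitz]
    consecutive points differ in the group by an element of size proportional to the length of a
    piece. *)
Lemma subdivision : exists2 C, 0 < C & exists2 e, 0 < e &
  forall x, chart_ball e x ->
  forall N, setpow (chart_ball (C / N.+1%:R)) N.+1 x.
Proof.
have [C C0 [e1 e10 hL]] := local_lipschitz.
have [e2 e20 h2] := ball_in_chart.
pose e := Num.min e1 (e2 / 2).
have e0 : 0 < e by rewrite lt_min e10 divr_gt0.
exists (C * e); first by rewrite mulr_gt0.
exists e => // x [cx hx] N.
pose v i := o + (i%:R / N.+1%:R) *: (cmap c x - o).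
have hv i : (i <= N.+1)%N -> `|v i - o| <= e.
  move=> iN; rewrite /v addrAC subrr add0r normrZ ger0_norm ?divr_ge0 //.
  apply: le_trans hx; rewrite ler_piMl // ler_pdivrMr ?ltr0n // mul1r.
  by rewrite ler_nat.
have Vv i : (i <= N.+1)%N -> V (v i).
  move=> /hv h; apply: h2; apply: le_lt_trans h _.
  by rewrite /e gt_min; apply/orP; right; lra.
have sv i : (i <= N.+1)%N -> chart_ball e1 (cinv c (v i)).
  move=> iN; have [? hc] := cinv_dom (Vv i iN); split=> //; rewrite hc.
  by apply: le_trans (hv i iN) _; rewrite /e ge_min lexx.
have -> : x = cinv c (v N.+1).
  by rewrite /v divff ?scale1r ?(addrC o) ?subrK ?cmapK // pnatr_eq0.
suff : forall i, (i <= N.+1)%N ->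
  setpow (chart_ball (C * e / N.+1%:R)) i (cinv c (v i)) by apply.
elim=> [_|i IH iN]; first by rewrite /v mul0r scale0r addr0 /o cmapK.
exists (cinv c (v i)); first by apply: IH; apply: ltnW.
exists ((cinv c (v i))^-1 * cinv c (v i.+1))%g; last by rewrite mulVKg.
have [d hd] := hL _ _ (sv i (ltnW iN)) (sv i.+1 iN); split=> //.
apply: le_trans hd _; rewrite -mulrA ler_pM2l //.
rewrite (cinv_dom (Vv i (ltnW iN))).2 (cinv_dom (Vv _ iN)).2.
have -> : v i.+1 - v i = N.+1%:R^-1 *: (cmap c x - o).
  rewrite /v opprD addrACA subrr add0r -scalerBl -mulrBl; congr (_ *: _).
  by rewrite -natr1 addrAC subrr add0r mul1r.
by rewrite normrZ ger0_norm // mulrC ler_wpM2r.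
Qed.

End Chart.
End LieGroup.

(** * Discrete cocompact subgroups *)

Section Lattice.
Context (R : realType) (n : nat) (G : lieGroupType R n) (pi : groupType).
Context (iota : {multiplicative pi -> G}) (nu : pi -> R).
Hypothesis lat : is_lattice iota.
Hypothesis nuM : forall x y, nu (x * y)%g <= nu x + nu y.

Lemma lattice_bounded_on_compact (K : set G) : compact K ->
  exists b, forall x, K (iota x) -> nu x <= b.
Proof.
have [inj disc _] := lat.
move=> /compact_near_coveringP /(_ nat \oo (fun m g => forall x, iota x = g ->
  nu x <= m%:R) _).
suff cov : forall g, K g -> \forall g' \near g &
  m \near \oo, forall x, iota x = g' -> nu x <= m%:R.
  move=> /(_ cov)[N _ /(_ N (leqnn N)) h].
  by exists N%:R => x Kx; apply: h Kx _ _.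
move=> g _.
(* By discreteness at the identity, applied to [p.1^-1 * p.2] near [(g, g)], some neighbourhood of
   [g] contains at most one lattice point. *)
have [U hU hU2] : exists2 U, nbhs g U & forall x y, U (iota x) -> U (iota y) ->
  x = y.
  have : \forall p \near (g, g), range iota (p.1^-1 * p.2)%g ->
    (p.1^-1 * p.2)%g = 1%g.
    have : (fun p : G * G => p.1^-1 * p.2)%g @ (g, g) --> (g^-1 * g)%g.
      by apply: lie_cvgM; [apply: lie_cvgV; exact: cvg_fst|exact: cvg_snd].
    rewrite mulVg => /(_ [set y | range iota y -> y = 1%g]); apply.
    by have := disc 1%g; apply; exists 1%g; rewrite ?hom1.
  move=> [[/= A1 A2] [hA1 hA2] hA]; exists (A1 `&` A2); first exact: filterI.
  move=> x y [x1 _] [_ y2]; have := hA (iota x, iota y) (conj x1 y2) => /= h.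
  apply: inj; apply: (mulgI (iota x)^-1%g); rewrite mulVg; apply/esym/h.
  by exists (x^-1 * y)%g; rewrite // gmulfM homV.
have [[x0 Ux0]|nx] := pselect (exists x, U (iota x)).
  have [N hN] : exists N : nat, nu x0 <= N%:R.
    by exists (Num.bound `|nu x0|);
      rewrite (le_trans (ler_norm _)) // ltW // archi_boundP.
  exists (U, [set m | (N <= m)%N]); first by split=> //; exists N.
  move=> [g' m] [/= Ug' Nm] x xg'.
  by rewrite (hU2 x x0) ?xg' // (le_trans hN) // ler_nat.
exists (U, setT); first by split=> //; exact: filterT.
by move=> [g' m] [/= Ug' _] x xg'; case: nx; exists x; rewrite xg'.
Qed.

Context (W : set G).
Hypotheses (cW : compact W) (W1 : nbhs (1%g : G) W) (cG : connected [set: G]).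

Lemma compactM (A B : set G) : compact A -> compact B ->
  compact [set (x * y)%g | x in A & y in B].
Proof.
move=> cA cB; rewrite -[X in compact X](_ : (fun p : G * G =>
  p.1 * p.2)%g @` (A `*` B) = _).
  apply: continuous_compact (compact_setX cA cB).
  by apply: continuous_subspaceT; exact: (@lie_mul_smooth R n G).1.
apply/seteqP; split=> [_ [[x y] [/= Ax By] <-]|_ [x Ax [y By <-]]].
  by exists x => //; exists y.
by exists (x, y).
Qed.

Lemma compactV (A : set G) : compact A -> compact [set (x^-1)%g | x in A].
Proof.
move=> cA; apply: continuous_compact cA.
by apply: continuous_subspaceT; exact: (@lie_inv_smooth R n G).1.
Qed.

Lemma setpow_compact m : compact (setpow W m).
Proof. by elim: m => [|m IH]; [exact: compact_set1|exact: compactM]. Qed.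

Local Open Scope quotient_scope.

(** The images of the powers of [W] increase and cover the quotient, each point having a
    neighbourhood inside one of them, so compactness selects a single power. *)
Lemma fundamental_domain : exists N, forall g, exists2 w, setpow W N w &
  exists x, g = (w * iota x)%g.
Proof.
have [_ _] := lat; set Q := quotient_topology _.
pose P m (q : Q) := exists2 w, setpow W m w & \pi_Q w = q.
move=> /compact_near_coveringP /(_ nat \oo P _).
have W1' : W 1%g by apply: nbhs_singleton.
have piE g h : \pi_Q g = \pi_Q h <-> exists x, iota x = (g^-1 * h)%g.
  split=> [/eqmodP/asboolP[x _ hx]|[x hx]]; first by exists x.
  by apply/eqmodP/asboolP; exists x.
suff cov : forall q : Q, setT q -> \forall q' \near q & m \near \oo, P m q'.
  move=> /(_ cov)[N _ /(_ N (leqnn N)) h]; exists N => g.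
  have [w hw /piE[x hx]] := h (\pi_Q g) I.
  by exists w => //; exists x; rewrite hx mulVKg.
move=> q _; rewrite -[q]reprK; set g := repr q.
have [m0 hm0] := connected_generated cG W1 g.
pose B := [set y | W (g^-1 * y)%g]^°.
have oB : open B by exact: open_interior.
have Bg : B g by exact: near_translate W1.
pose U : set Q := [set q' | exists2 y, B y & \pi_Q y = q'].
(* The preimage of [U] is the union of the right translates of [B] by lattice elements, hence
   open. *)
have oU : open U.
  suff : open (\pi_Q @^-1` U) by [].
  rewrite openE => y [b Bb /piE[x hx]].
  have : (fun z => z * (iota x)^-1)%g @ y --> (y * (iota x)^-1)%g.
    by apply: lie_cvgM; [exact: cvg_id|exact: cvg_cst].
  have -> : (y * (iota x)^-1)%g = b by rewrite hx invgM invgK mulVKg.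
  move=> /(_ B (open_nbhs_nbhs (conj oB Bb))) hB.
  suff : nbhs y (\pi_Q @^-1` U) by [].
  apply: (@filterS _ (nbhs y) _ _ _ _ hB) => z Bz;
    exists (z * (iota x)^-1)%g => //.
  by apply/piE; exists x; rewrite invgM invgK mulgVK.
exists (U, [set m | (m0.+1 <= m)%N]).
  split; last by exists m0.+1.
  by apply: open_nbhs_nbhs; split=> //; exists g.
move=> [q' m] [/= [y /interior_subset /= Wy <-] hm]; exists y => //.
apply: (setpow_le W1' hm); exists g => //; exists (g^-1 * y)%g => //.
by rewrite mulVKg.
Qed.

(* Milnor-Schwarz: follow a product of elements of [W] by the nearest lattice
   points; consecutive ones differ by an element of a fixed compact set. *)
Lemma lattice_length_bound : exists K, forall m x, setpow W m (iota x) ->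
  nu x <= K * m.+1%:R.
Proof.
have [N hN] := fundamental_domain.
have cWN : compact (setpow W N) by exact: setpow_compact.
have cWV : compact [set (x^-1)%g | x in setpow W N] by exact: compactV.
have [b1 h1] := lattice_bounded_on_compact cWN.
have [b2 h2] := lattice_bounded_on_compact cWV.
have [|b3 h3] := @lattice_bounded_on_compact
    [set (x * y)%g | x in [set (x * y)%g | x in [set (x^-1)%g | x in setpow W
      N] & y in W] & y in setpow W N].
  by apply: compactM cWN; exact: compactM.
(* Applying the fundamental domain to [g^-1] puts the lattice element on the left. *)
have dom g : exists x f, g = (iota x * f)%g /\ setpow W N (f^-1)%g.
  have [w hw [x hx]] := hN (g^-1)%g; exists (x^-1)%g, (w^-1)%g.
  by rewrite invgK homV -invgM -hx invgK.
have near_lat m g : setpow W m g -> exists x f,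
    [/\ g = (iota x * f)%g, setpow W N (f^-1)%g &
      nu x <= (`|b1| + `|b3|) * m.+1%:R].
  elim: m g => [g ->|m IH _ [g hg [y Wy <-]]].
    have [x [f [hx hf]]] := dom 1%g; exists x, f; split=> //.
    have /h1 : setpow W N (iota x) by move/esym/eqP: hx;
      rewrite mulg_eq1 => /eqP->.
    by rewrite mulr1; have := ler_norm b1; have := normr_ge0 b3; lra.
  have [x [f [-> hf hx]]] := IH g hg.
  (* [f * y] is decomposed anew; its lattice part is [f * y * f'^-1], in the compact set of [h3], so
     each factor from [W] adds at most [b3]. *)
  have [x' [f' [hx' hf']]] := dom (f * y)%g.
  exists (x * x')%g, f'; split=> //; first by rewrite gmulfM -mulgA hx' !mulgA.
  have /h3 hb : [set (x * y)%g | x in [set (x * y)%g | x in [set (x^-1)%g | x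
    in setpow W N] & y in W]
      & y in setpow W N] (iota x').
    exists (f * y)%g; first by exists f; [exists (f^-1)%g => //;
      rewrite invgK|exists y].
    by exists (f'^-1)%g => //; rewrite hx' mulgK.
  apply: le_trans (nuM _ _) _; rewrite -natr1 mulrDr mulr1; apply: lerD => //.
  by have := ler_norm b3; have := normr_ge0 b1; lra.
exists (`|b1| + `|b3| + `|b2|) => m x /near_lat[x0 [f [hx hf h0]]].
have /h2 hb : [set (x^-1)%g | x in setpow W N] (iota (x0^-1 * x)%g).
  by exists (f^-1)%g => //; rewrite invgK gmulfM homV hx mulKg.
rewrite -[x](mulVKg x0) (le_trans (nuM _ _)) // mulrDl; apply: lerD => //.
have m1 : 1 <= m.+1%:R :> R by rewrite ler1n.
by have := ler_norm b2; have := normr_ge0 b2; nra.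
Qed.

End Lattice.

(** * Iteration of [D] near the identity *)

Section Dynamics.
Context (R : realType) (n : nat) (G : lieGroupType R n).
Context (D : {multiplicative G -> G}) (c : chart R n G).
Hypotheses (cA : @atlas R n G c) (c1 : cdom c (1%g : G)) (sD : smooth_map D).
Local Notation J := (linearization c D).
Let o := cmap c 1%g.

Lemma contraction_near_identity r : sp J < r ->
  exists Nm K, adapted_norm J r Nm K /\ exists2 e, 0 < e &
    forall x, chart_ball c e x ->
    cdom c (D x) /\ Nm (cmap c (D x) - o) <= r * Nm (cmap c x - o).
Proof.
move=> hr; have [cD /(_ c c cA cA)] := sD.
set A := (X in smooth_on X); set f := (X in smooth_on _ X) =>
  -[oA /(_ 1%N) [df _]].
have fo : f o = o by rewrite /f /o /= cmapK // hom1.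
have [|Nm [K [hN hc]]] := local_contraction (df o _) fo hr.
  by exists 1%g => //; split=> //=; rewrite hom1.
exists Nm, K; split=> //; apply: chart_ball_near => //.
have h1 : \forall x \near (1%g : G), cdom c x.
  by apply: open_nbhs_nbhs; split=> //; exact: cdom_open.
have h2 : \forall x \near (1%g : G), cdom c (D x).
  have D1 : D @ (1%g : G) --> (1%g : G) by rewrite -[X in _ --> X](hom1 D);
    exact: cD.
  apply: D1.
  by apply: open_nbhs_nbhs; split=> //; exact: cdom_open.
have h3 : \forall x \near (1%g :
  G), Nm (f (cmap c x) - o) <= r * Nm (cmap c x - o).
  exact: (cmap_cvg c1 hc).
near=> x; split; first by near: x.
have : cdom c x by near: x.
have : Nm (f (cmap c x) - o) <= r * Nm (cmap c x - o) by near: x.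
by rewrite /f /= => + cx; rewrite cmapK.
Unshelve. all: by end_near. Qed.

Section Orbit.
Variables (r K e : R) (Nm : 'rV[R]_n -> R).
Hypotheses (r0 : 0 < r) (hN : adapted_norm J r Nm K) (e0 : 0 < e).
Hypothesis hD : forall x, chart_ball c e x ->
  cdom c (D x) /\ Nm (cmap c (D x) - o) <= r * Nm (cmap c x - o).

(** The hypothesis for all [j <= k] keeps the orbit in the ball of radius [e], where one application
    of [D] stretches [Nm] by at most [r]. *)
Lemma orbit_bound k x : cdom c x ->
  (forall j, (j <= k)%N -> r ^+ j * Nm (cmap c x - o) <= e) ->
  chart_ball c e (iter k D x) /\ Nm (cmap c (iter k D x) - o) <= r ^+ k * Nm
    (cmap c x - o).
Proof.
have [_ leN _ _ _] := hN.
move=> cx; elim: k => [|k IH] hk.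
  rewrite expr0 mul1r; split=> //; split=> //.
  by have := hk 0 (leqnn 0); rewrite expr0 mul1r; apply: le_trans (leN _).
have [|sk nk] := IH; first by move=> j jk; apply: hk; apply: leqW.
have [ck1 nk1] := hD sk.
have {}nk1 : Nm (cmap c (iter k.+1 D x) - o) <= r ^+ k.+1 * Nm (cmap c x - o).
  by apply: le_trans nk1 _; rewrite exprS -mulrA ler_wpM2l // ltW.
split=> //; split=> //.
by apply: le_trans (leN _) _; apply: le_trans nk1 (hk _ (leqnn _)).
Qed.

Lemma orbit_length : connected [set: G] -> 1 <= r ->
  forall g, exists C, forall k, exists2 M, M%:R <= C * r ^+ k &
    setpow (chart_ball c e) M (iter k D g).
Proof.
move=> cG r1 g; have [K0 leN hK _ _] := hN.
have [C C0 [d d0 hsub]] := subdivision cA c1.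
have [m hm] := connected_generated cG (near_chart_ball c1 d0) g.
have q0 : 0 <= K * C / e by rewrite divr_ge0 ?mulr_ge0 // ltW.
exists (m%:R * (K * C / e + 1)) => k.
(* [N] is of order [r ^+ k] and such that an element of size [C / N.+1] stays within [e] under [k]
   iterations, [Nm] being at most [K] times the norm. *)
pose N := Num.trunc (K * C * r ^+ k / e).
have rk : 1 <= r ^+ k by rewrite exprn_ege1.
have y0 : 0 <= K * C * r ^+ k / e.
  by rewrite mulrAC mulr_ge0 // (le_trans _ rk).
have /andP[hN1 hN2] := truncn_itv y0.
exists (m * N.+1)%N.
  rewrite natrM -mulrA ler_wpM2l // -natr1.
  have : N%:R <= K * C / e * r ^+ k by rewrite [leRHS]mulrAC.
  lra.
have hg : setpow (chart_ball c (C / N.+1%:R)) (m * N.+1) g.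
  by apply: setpow_mul hm => x /hsub.
apply: (setpow_hom (f := iter_hom D k) _ hg).
move=> x [cx hx].
have hj j : (j <= k)%N -> r ^+ j * Nm (cmap c x - o) <= e.
  move=> jk; apply: (@le_trans _ _ (r ^+ k * (K * (C / N.+1%:R)))).
    apply: ler_pM.
    - by rewrite exprn_ge0 // ltW.
    - exact: le_trans (leN _).
    - by rewrite ler_weXn2l.
    - by apply: le_trans (hK _) _; rewrite ler_pM2l.
  have -> : r ^+ k * (K * (C / N.+1%:R)) = (K * C * r ^+ k) / N.+1%:R by ring.
  by rewrite ler_pdivrMr ?ltr0n // [leRHS]mulrC -ler_pdivrMr // ltW.
by have [] := orbit_bound cx hj.
Qed.

(** [g] is a product of elements of the chart ball of radius [e / K], whose adapted norm is at most
    [e]; each has an orbit converging geometrically to the identity, and multiplication is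
    continuous. *)
Lemma orbit_cvg : connected [set: G] -> r < 1 -> forall g, (fun k =>
  iter k D g) @ \oo --> (1%g : G).
Proof.
move=> cG r1 g; have [K0 leN hK _ _] := hN.
have ek : 0 < e / K by rewrite divr_gt0.
have [m] := connected_generated cG (near_chart_ball c1 ek) g.
elim: m g => [g ->|m IH _ [x hx [y [cy hy] <-]]].
  rewrite (_ : (fun k => iter k D 1%g) = cst 1%g); first exact: cvg_cst.
  by apply/funext => k; rewrite (hom1 (iter_hom D k)).
have -> : (fun k => iter k D (x * y)%g) = (fun k => iter k D x * iter k D y)%g.
  by apply/funext => k; rewrite iter_homM.
rewrite -[X in _ --> X]mulg1; apply: lie_cvgM; first exact: IH.
have Ny : Nm (cmap c y - o) <= e.
  by apply: le_trans (hK _) _; rewrite mulrC -ler_pdivlMr.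
have Ny0 : 0 <= Nm (cmap c y - o) by rewrite (le_trans _ (leN _)).
have hj k j : (j <= k)%N -> r ^+ j * Nm (cmap c y - o) <= e.
  by move=> _; apply: le_trans Ny; rewrite ler_piMl // exprn_ile1 // ltW.
have orb k := orbit_bound cy (hj k).
have hcv : (fun k => cmap c (iter k D y)) @ \oo --> o.
  apply/cvgrPdist_le => t t0.
  have : \forall k \near \oo, r ^+ k <= t / (e + 1).
    by apply: exp_near_le => //; [exact: ltW|rewrite divr_gt0 // addr_gt0].
  apply: filterS => k hk; rewrite distrC.
  apply: le_trans (leN _) _; apply: le_trans (orb k).2 _.
  apply: (@le_trans _ _ (t / (e + 1) * (e + 1)));
    last by rewrite divfK // gt_eqF // addr_gt0.
  by apply: ler_pM => //; [rewrite exprn_ge0 // ltW|lra].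
have : (fun k => cinv c (cmap c (iter k D y))) @ \oo --> cinv c o.
  exact: (cvg_comp _ _ hcv (cinv_cvg (Vo c1))).
rewrite /o cmapK //; apply: cvg_trans; apply: near_eq_cvg; near=> k.
by rewrite cmapK //; have [[]] := orb k.
Unshelve. all: by end_near. Qed.

End Orbit.

End Dynamics.

(** * Comparison of [D1] with the linearization *)

Section LinearizationBound.
Context (R : realType) (pi : groupType) (phi : {multiplicative pi -> pi}).
Context (n : nat) (G : lieGroupType R n) (iota : {multiplicative pi -> G}).
Context (D : {multiplicative G -> G}) (c : chart R n G).
Context (k : nat) (s : 'I_k -> pi) (D1 : 'M[int]_k).
Hypotheses (cA : @atlas R n G c) (c1 : cdom c (1%g : G)).
Hypotheses (lat : is_lattice iota) (cG : connected [set: G]).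
Hypothesis ext : is_malcev_extension iota phi D.
Hypotheses (basis : isolator_basis 1 s) (D1P : induced_matrix phi 1 s D1).
Local Notation D1R := (map_mx (fun z : int => z%:~R : R) D1).
Local Notation J := (linearization c D).

Lemma iter_iota m x : iter m D (iota x) = iota (iter m phi x).
Proof. by elim: m => //= m ->; rewrite ext.2. Qed.

(** By [orbit_length], [D ^ m] sends a lattice element to a product of at most [C * r ^+ m] elements
    of a compact ball. With [l1norm] of the coordinates as [nu], [lattice_length_bound] then bounds
    the entries of [D1 ^+ m] by a multiple of [r ^+ m]. *)
Lemma sp_le_expanding r : 1 <= r -> sp J < r -> sp D1R <= r.
Proof.
move=> r1 hr; have r0 : 0 < r by rewrite (lt_le_trans _ r1).
have [Nm [K [hN [e1 e10 hD]]]] := contraction_near_identity cA c1 ext.1 hr.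
have [e2 e20 he2] := chart_ball_compact c1.
pose e := Num.min e1 e2.
have e0 : 0 < e by rewrite lt_min e10.
have {}hD x (hx : chart_ball c e x) := hD x (chart_ballS (_ : e <= e1) hx).
have [||B hB] := @lattice_length_bound R n G pi iota (fun x =>
  l1norm R (abcoord basis x)) lat _
    (chart_ball c e) _ (near_chart_ball c1 e0) cG.
- by move=> x y; rewrite abcoordM l1normD.
- by apply: he2; rewrite ge_min lexx orbT.
have [|l _|C C0 hC] := @uniform_bound R _ (enum 'I_k)
  (fun l C => forall m, l1norm R (abcoord basis (iter m phi (s l))) <= C * r ^+
    m).
- move=> x b b' bb' h m; apply: le_trans (h m) _.
  by rewrite ler_wpM2r // exprn_ge0 // ltW.
- have [|C hC] := orbit_length cA c1 r0 hN e0 _ cG r1 (iota (s l)).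
    by move=> x hx; apply: hD => //; rewrite ge_min lexx.
  exists (`|B| * (C + 1)) => m; have [M hM] := hC m; rewrite iter_iota => /hB h.
  apply: le_trans h _; apply: (@le_trans _ _ (`|B| * M.+1%:R)).
    by rewrite ler_wpM2r // ler_norm.
  rewrite -mulrA ler_wpM2l // -natr1 mulrDl mul1r lerD //.
  by rewrite exprn_ege1.
apply: (@sp_le_of_power_bound R k D1 r C); first exact: ltW.
move=> m i j; rewrite -(abcoord_iter_basis basis D1P).
by apply: le_trans (hC j _ m); rewrite ?l1norm_entry ?mem_enum.
Qed.

(** The orbits of the basis converge to the identity inside a discrete lattice, so they reach it and
    a power of [D1] vanishes. [N.+1] is a positive exponent, as [sp_lower_bound] requires. *)
Lemma sp_eq0_contracting r : 0 < r -> r < 1 -> sp J < r -> sp D1R = 0.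
Proof.
move=> r0 r1 hr.
have [Nm [K [hN [e e0 hD]]]] := contraction_near_identity cA c1 ext.1 hr.
have [inj disc _] := lat.
have triv l : \forall m \near \oo, iter m phi (s l) = 1%g.
  have h1 : \forall y \near (1%g : G), range iota y -> y = 1%g.
    by apply: disc; exists 1%g; rewrite ?hom1.
  have h2 : \forall m \near \oo, range iota (iter m D (iota (s l))) ->
    iter m D (iota (s l)) = 1%g.
    exact: (orbit_cvg c1 r0 hN e0 hD cG r1 (iota (s l)) h1).
  apply: filterS h2 => m /= h; apply: inj; rewrite hom1 -iter_iota; apply: h.
  by rewrite iter_iota; exists (iter m phi (s l)).
have [N _ hN0] := filter_forall _ triv.
have [b b0 hb] := sp_lower_bound D1R.
have spN : b * sp D1R ^+ N.+1 <= 0.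
  apply: hb => // i j; rewrite intr_mxX -(abcoord_iter_basis basis D1P).
  by rewrite (hN0 _ (leqnSn N)) abcoord1 mxE normr0.
apply/eqP; move: spN; rewrite pmulr_rle0 // => spN.
have : sp D1R ^+ N.+1 == 0 by rewrite eq_le spN exprn_ge0 // sp_ge0.
by rewrite expf_eq0.
Qed.

(** If the inequality failed, a rate [r] strictly between the two radii would contradict the
    expanding or the contracting case, according to its position relative to 1. *)
Lemma sp_le_linearization : sp D1R <= sp J.
Proof.
rewrite leNgt; apply/negP => lt; pose r := (sp J + sp D1R) / 2.
have J0 := sp_ge0 J.
have Jr : sp J < r by rewrite /r; lra.
have rD : r < sp D1R by rewrite /r; lra.
have [r1|r1] := leP 1 r; first by have := sp_le_expanding r1 Jr; lra.
by have := sp_eq0_contracting (le_lt_trans J0 Jr) r1 Jr; lra.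
Qed.


End LinearizationBound.

Theorem theorem3p5 (R : realType) (pi : groupType)
    (S : seq pi) (phi : {multiplicative pi -> pi})
    (Sab : seq (abelianization pi))
    (n : nat) (G : lieGroupType R n)
    (iota : {multiplicative pi -> G}) (D : {multiplicative G -> G})
    (c : chart R n G)
    (k1 : nat) (S1 : 'I_k1 -> pi) (D1 : 'M[int]_k1) :
  generates S -> torsion_free pi -> nilpotent_group pi ->
  generates Sab ->
  is_malcev_completion iota -> is_malcev_extension iota phi D ->
  @atlas R n G c -> cdom c 1%g ->
  isolator_basis 1 S1 -> induced_matrix phi 1 S1 D1 ->
  [/\ GR R phi S = GR R (ab_map phi) Sab,
      GR R phi S = sp (map_mx (fun z : int => z%:~R : R) D1) &
      sp (map_mx (fun z : int => z%:~R : R) D1) <= sp (linearization c D)].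
Proof.
move=> genS tf nil genSab [[cG _] _ lat] ext cA c1 basis D1P.
have GRphi := growth_rate_group R genS tf nil basis D1P.
split=> //; first by rewrite GRphi (growth_rate_ab R genS tf nil basis D1P
  genSab).
exact: (sp_le_linearization cA c1 lat cG ext basis D1P).
Qed.
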